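(* The $2$-functor $\Gamma$ induces a weak equivalence between the $2$-categories of $0$-free stable quadratic modules and Picard groupoids.
   Context: Groups are additive, $[x,y]=-x-y+x+y$. A stable quadratic module $C_*$ consists of homomorphisms $C_0^{ab}\otimes C_0^{ab}\xrightarrow{\langle\cdot,\cdot\rangle}C_1\xrightarrow{\partial}C_0$ with $\langle c_0,c_0'\rangle+\langle c_0',c_0\rangle=0$, $\partial\langle c_0,c_0'\rangle=[c_0',c_0]$, $\langle\partial c_1,\partial c_1'\rangle=[c_1',c_1]$; $C_0$ acts on $C_1$ by $c_1^{c_0}=c_1+\langle c_0,\partial c_1\rangle$. A morphism $f\colon C_*\to D_*$ is a pair of homomorphisms compatible with $\partial$ and bracket. A homotopy $\alpha\colon f\Rightarrow g$ is a function $\alpha\colon C_0\to D_1$ with $\alpha(c_0+c_0')=\alpha(c_0)^{g_0(c_0')}+\alpha(c_0')$, $\partial\alpha(c_0)=-g_0(c_0)+f_0(c_0)$, $\alpha\partial(c_1)=-g_1(c_1)+f_1(c_1)$. These form a $2$-category; horizontal composition is composition of maps, and the vertical composite of $f\overset{\alpha}\Rightarrow g\overset{\beta}\Rightarrow h$ is $\beta+\alpha$. $C_*$ is $0$-free if $C_0$ is a free group of nilpotency class $2$ on some set (quotient of a free group by triple commutators). Picard groupoids are symmetric monoidal groupoids in which tensoring with any object is an equivalence; they form a $2$-category with symmetric tensor functors and tensor natural transformations. $\Gamma C_*$ has object set $C_0$, morphisms $(c_0,c_1)\colon c_0+\partial c_1\to c_0$ ($c_i\in C_i$), composition $(c_0,c_1)\circ(c_0+\partial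 c_1,c_1')=(c_0,c_1+c_1')$, strict tensor product $+$ on objects and $(c_0,c_1)+(c_0',c_1')=(c_0+c_0',c_1^{c_0'}+c_1')$ on morphisms, unit $0$, symmetry $(c_0'+c_0,\langle c_0',c_0\rangle)\colon c_0+c_0'\to c_0'+c_0$. A morphism $f$ induces the strict tensor functor $\Gamma f$ given by $f_0$ on objects and $(c_0,c_1)\mapsto(f_0(c_0),f_1(c_1))$ on morphisms; a homotopy $\alpha\colon f\Rightarrow g$ induces $(\Gamma\alpha)(c_0)=(g_0(c_0),\alpha(c_0))$. A weak equivalence of $2$-categories is a $2$-functor which is fully faithful on $2$-morphisms, essentially surjective on $1$-morphisms, and such that any object in the target is equivalent (in the $2$-categorical sense) to an object in the image. *)

(* Defs.v *)
From HB Require Import structures.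
From mathcomp Require Import all_boot boolp.

Set Implicit Arguments.
Unset Strict Implicit.
Unset Printing Implicit Defensive.

Local Obligation Tactic := try by [].

Local Open Scope group_scope.
Local Open Scope quotient_scope.

Declare Scope cat_scope.
Delimit Scope cat_scope with cat.
Local Open Scope cat_scope.

Reserved Notation "g \oc f" (at level 40, left associativity).

Record category := Category {
  obj :> Type;
  hom : obj -> obj -> Type;
  idm : forall x, hom x x;
  cmp : forall x y z, hom y z -> hom x y -> hom x z;
  cmpA : forall w x y z (h : hom y z) (g : hom x y) (f : hom w x),
    cmp h (cmp g f) = cmp (cmp h g) f;
  cmp1m : forall x y (f : hom x y), cmp (idm y) f = f;
  cmpm1 : forall x y (f : hom x y), cmp f (idm x) = f }.

Arguments idm {C} x : rename.
Notation "g \oc f" := (cmp g f) : cat_scope.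

Definition is_iso (C : category) (x y : C) (f : hom x y) : Prop :=
  exists g : hom y x, g \oc f = idm x /\ f \oc g = idm y.

Definition isomorphic (C : category) (x y : C) : Prop :=
  exists f : hom x y, is_iso f.

Record functor (C D : category) := Functor {
  fob :> C -> D;
  fmap : forall x y, hom x y -> hom (fob x) (fob y);
  fmap1 : forall x, fmap (idm x) = idm (fob x);
  fmapM : forall x y z (g : hom y z) (f : hom x y),
    fmap (g \oc f) = fmap g \oc fmap f }.

Arguments fmap {C D} F {x y} : rename.

Program Definition functor_id (C : category) : functor C C :=
  @Functor C C id (fun x y f => f) _ _.

Program Definition functor_comp (C D E : category)
    (G : functor D E) (F : functor C D) : functor C E :=
  @Functor C E (fun x => G (F x)) (fun x y f => fmap G (fmap F f)) _ _.
Next Obligation. by move=> C D E G F x /=; rewrite !fmap1. Qed.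
Next Obligation. by move=> C D E G F x y z g f /=; rewrite !fmapM. Qed.

Definition nat_isomorphic (C D : category) (F G : functor C D) : Prop :=
  exists t : forall x, hom (F x) (G x),
    (forall x y (f : hom x y), t y \oc fmap F f = fmap G f \oc t x) /\
    (forall x, is_iso (t x)).

Definition is_equivalence (C D : category) (F : functor C D) : Prop :=
  exists G : functor D C,
    nat_isomorphic (functor_comp G F) (functor_id C) /\
    nat_isomorphic (functor_comp F G) (functor_id D).

(* The morphisms of C regardless of source and target: the equality of two
   arrows includes the equality of their sources and of their targets.  It
   serves to state the laws whose two sides have sources and targets that are
   equal, but not convertible. *)
Definition arrow (C : category) := {x : C & {y : C & hom x y}}.

Definition mkarrow (C : category) (x y : C) (f : hom x y) : arrow C :=
  existT _ x (existT _ y f).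

(* The morphisms of the category [hom1 a b] are the 2-morphisms, its
   composition is the vertical one. *)
Record twocat := TwoCat {
  obj2 :> Type;
  hom1 : obj2 -> obj2 -> category;
  id1 : forall a, hom1 a a;
  cmp1 : forall a b c, hom1 b c -> hom1 a b -> hom1 a c;
  hcmp : forall a b c (g g' : hom1 b c) (f f' : hom1 a b),
    hom g g' -> hom f f' -> hom (cmp1 g f) (cmp1 g' f');
  hcmp1 : forall a b c (g : hom1 b c) (f : hom1 a b),
    hcmp (idm g) (idm f) = idm (cmp1 g f);
  hcmpM : forall a b c (g g' g'' : hom1 b c) (f f' f'' : hom1 a b)
      (t' : hom g' g'') (t : hom g g') (s' : hom f' f'') (s : hom f f'),
    hcmp (t' \oc t) (s' \oc s) = hcmp t' s' \oc hcmp t s;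
  cmp1A : forall a b c d (h : hom1 c d) (g : hom1 b c) (f : hom1 a b),
    cmp1 h (cmp1 g f) = cmp1 (cmp1 h g) f;
  cmp1_idl : forall a b (f : hom1 a b), cmp1 (id1 b) f = f;
  cmp1_idr : forall a b (f : hom1 a b), cmp1 f (id1 a) = f;
  hcmpA : forall a b c d (h h' : hom1 c d) (g g' : hom1 b c) (f f' : hom1 a b)
      (u : hom h h') (t : hom g g') (s : hom f f'),
    mkarrow (hcmp u (hcmp t s)) = mkarrow (hcmp (hcmp u t) s);
  hcmp_idl : forall a b (f f' : hom1 a b) (s : hom f f'),
    mkarrow (hcmp (idm (id1 b)) s) = mkarrow s;
  hcmp_idr : forall a b (f f' : hom1 a b) (s : hom f f'),
    mkarrow (hcmp s (idm (id1 a))) = mkarrow s }.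

Arguments id1 {K} a : rename.

Definition equivalent (K : twocat) (a b : K) : Prop :=
  exists (f : hom1 a b) (g : hom1 b a),
    isomorphic (cmp1 g f) (id1 a) /\ isomorphic (cmp1 f g) (id1 b).

Record twofunctor (K L : twocat) := TwoFunctor {
  fob2 :> K -> L;
  fhom : forall a b, functor (hom1 a b) (hom1 (fob2 a) (fob2 b));
  fhom_id : forall a, fhom a a (id1 a) = id1 (fob2 a);
  fhom_cmp : forall a b c (g : hom1 b c) (f : hom1 a b),
    fhom a c (cmp1 g f) = cmp1 (fhom b c g) (fhom a b f);
  fhom_hcmp : forall a b c (g g' : hom1 b c) (f f' : hom1 a b)
      (t : hom g g') (s : hom f f'),
    mkarrow (fmap (fhom a c) (hcmp t s)) =
    mkarrow (hcmp (fmap (fhom b c) t) (fmap (fhom a b) s)) }.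

Arguments fhom {K L} T {a b} : rename.

Definition weak_equivalence (K L : twocat) (T : twofunctor K L) : Prop :=
  [/\ forall (a b : K) (f g : hom1 a b),
        bijective (fun s : hom f g => fmap (fhom T) s),
      forall (a b : K) (h : hom1 (T a) (T b)),
        exists f : hom1 a b, isomorphic (fhom T f) h
    & forall x : L, exists a : K, equivalent (T a) x].

Definition full_twocat (K : twocat) (P : K -> Prop) : twocat :=
  @TwoCat {a : K | P a}
    (fun a b => hom1 (sval a) (sval b))
    (fun a => id1 (sval a))
    (fun a b c g f => cmp1 g f)
    (fun a b c g g' f f' t s => hcmp t s)
    (fun a b c => @hcmp1 K _ _ _) (fun a b c => @hcmpM K _ _ _)
    (fun a b c d => @cmp1A K _ _ _ _)
    (fun a b => @cmp1_idl K _ _) (fun a b => @cmp1_idr K _ _)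
    (fun a b c d => @hcmpA K _ _ _ _)
    (fun a b => @hcmp_idl K _ _) (fun a b => @hcmp_idr K _ _).

Definition full_twofunctor (K L : twocat) (P : K -> Prop) (T : twofunctor K L) :
    twofunctor (full_twocat P) L :=
  @TwoFunctor (full_twocat P) L
    (fun a => T (sval a)) (fun a b => @fhom K L T (sval a) (sval b))
    (fun a => @fhom_id K L T (sval a))
    (fun a b c => @fhom_cmp K L T _ _ _)
    (fun a b c => @fhom_hcmp K L T _ _ _).

Lemma existT_inj2 (A : Type) (P : A -> Type) (x : A) (a b : P x) :
  existT P x a = existT P x b -> a = b.
Proof.
move=> e; have /= := projT2_eq e.
by rewrite (Prop_irrelevance (projT1_eq e) erefl).
Qed.

Lemma mkarrow_inj (C : category) (x y : C) (f g : hom x y) :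
  mkarrow f = mkarrow g -> f = g.
Proof. by move=> e; apply: existT_inj2; apply: existT_inj2 e. Qed.

(* Groups are written multiplicatively: [x * y], [1], [x^-1] and
   [~ x, y] = x^-1 * (y^-1 * (x * y)) stand for x + y, 0, -x and
   [x, y] = -x - y + x + y.

   A homomorphism out of the tensor product of the abelianization of [sq0]
   with itself is given as the biadditive map on [sq0] it corresponds to.
   There is no loss in letting it start from [sq0] nor in [sq1] not being
   abelian: see [brk_comml] and [brkC] below, which only use [brkMl] and
   [brkMr]. *)
Record sqmod := SQMod {
  sq0 : groupType;
  sq1 : groupType;
  bd : UMagmaMorphism.type sq1 sq0;
  brk : sq0 -> sq0 -> sq1;
  brkMl : forall x y z, brk (x * y) z = brk x z * brk y z;
  brkMr : forall x y z, brk x (y * z) = brk x y * brk x z;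
  brk_anti : forall x y, brk x y * brk y x = 1;
  bd_brk : forall x y, bd (brk x y) = [~ y, x];
  brk_bd : forall a b, brk (bd a) (bd b) = [~ b, a] }.

Arguments bd {C} : rename.

Section SQModTheory.
Variable C : sqmod.
Implicit Types (x y z : sq0 C) (a b c : sq1 C).

Lemma brkC x y z t : brk x y * brk z t = brk z t * brk x y.
Proof.
have e : brk (x * z) (t * y) = brk (x * z) (t * y) by [].
rewrite {1}brkMl !brkMr brkMl [in RHS]brkMl in e.
move: e; rewrite -!mulgA => /mulgI; rewrite !mulgA => /mulIg ->.
by [].
Qed.

Lemma brk1l x : brk 1 x = 1 :> sq1 C.
Proof. by apply: (@mulgI _ (brk 1 x)); rewrite -brkMl !mulg1. Qed.

Lemma brk1r x : brk x 1 = 1 :> sq1 C.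
Proof. by apply: (@mulgI _ (brk x 1)); rewrite -brkMr !mulg1. Qed.

Lemma brkVl x y : brk x^-1 y = (brk x y)^-1.
Proof. by apply: (@mulgI _ (brk x y)); rewrite -brkMl !mulgV brk1l. Qed.

Lemma brkVr x y : brk x y^-1 = (brk x y)^-1.
Proof. by apply: (@mulgI _ (brk x y)); rewrite -brkMr !mulgV brk1r. Qed.

Lemma brk_comml x y z : brk [~ x, y] z = 1.
Proof.
by rewrite /commg /conjg !brkMl !brkVl (brkC x z y z) mulKg mulVg.
Qed.

Lemma brk_commr x y z : brk z [~ x, y] = 1.
Proof.
by rewrite /commg /conjg !brkMr !brkVr (brkC z x z y) mulKg mulVg.
Qed.

Lemma brk_antiV x y : brk y x = (brk x y)^-1.
Proof. by symmetry; apply: mulg1_eq; rewrite brk_anti. Qed.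

Lemma brk_central x y a : brk x y * a = a * brk x y.
Proof.
by apply/commgP/eqP; rewrite -brk_bd bd_brk brk_commr.
Qed.

Definition act a x := a * brk x (bd a).

Lemma actM a b x : act (a * b) x = act a x * act b x.
Proof.
rewrite /act gmulfM brkMr !mulgA; congr (_ * _).
by rewrite -!mulgA brk_central.
Qed.

Lemma actV a x : act a^-1 x = (act a x)^-1.
Proof. by rewrite /act gmulfV brkVr -brk_central invgM. Qed.

Lemma act1 x : act 1 x = 1.
Proof. by rewrite /act gmulf1 brk1r mulg1. Qed.

Lemma act_brk x y z : act (brk x y) z = brk x y.
Proof. by rewrite /act bd_brk brk_commr mulg1. Qed.

Lemma act_id a : act a 1 = a.
Proof. by rewrite /act brk1l mulg1. Qed.

Lemma act_mul a x y : act a (x * y) = act (act a x) y.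
Proof. by rewrite /act gmulfM bd_brk brkMl brkMr brk_commr mulg1 mulgA. Qed.

Lemma act_bd a b : act a (bd b) = a ^ b.
Proof. by rewrite /act brk_bd /commg mulVKg. Qed.

Lemma bd_act a x : bd (act a x) = bd a ^ x.
Proof. by rewrite /act gmulfM bd_brk /commg mulVKg. Qed.

End SQModTheory.

Record sqmor (C D : sqmod) := SQMor {
  mor0 : UMagmaMorphism.type (sq0 C) (sq0 D);
  mor1 : UMagmaMorphism.type (sq1 C) (sq1 D);
  mor_bd : forall a, mor0 (bd a) = bd (mor1 a);
  mor_brk : forall x y, mor1 (brk x y) = brk (mor0 x) (mor0 y) }.

Lemma mor_act (C D : sqmod) (f : sqmor C D) a x :
  mor1 f (act a x) = act (mor1 f a) (mor0 f x).
Proof. by rewrite /act gmulfM mor_brk mor_bd. Qed.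

Lemma umagma_eq (G H : baseUMagmaType) (f g : UMagmaMorphism.type G H) :
  (forall x, f x = g x) -> f = g.
Proof.
case: f => f [[f1] [fM]]; case: g => g [[g1] [gM]] /= /funext e.
by rewrite {}e in f1 fM *; rewrite (Prop_irrelevance f1 g1) (Prop_irrelevance fM gM).
Qed.

Lemma sqmor_eq (C D : sqmod) (f g : sqmor C D) :
  (forall x, mor0 f x = mor0 g x) -> (forall a, mor1 f a = mor1 g a) -> f = g.
Proof.
case: f => f0 f1 fd fb; case: g => g0 g1 gd gb /= /umagma_eq e0 /umagma_eq e1.
subst g0 g1.
by rewrite (Prop_irrelevance fd gd) (Prop_irrelevance fb gb).
Qed.

Program Definition sqmor_id (C : sqmod) : sqmor C C :=
  @SQMor C C idfun idfun _ _.

Program Definition sqmor_comp (C D E : sqmod) (g : sqmor D E) (f : sqmor C D) :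
    sqmor C E :=
  @SQMor C E (mor0 g \o mor0 f) (mor1 g \o mor1 f) _ _.
Next Obligation. by move=> C D E g f a /=; rewrite !mor_bd. Qed.
Next Obligation. by move=> C D E g f x y /=; rewrite !mor_brk. Qed.

Record homotopy (C D : sqmod) (f g : sqmor C D) := Homotopy {
  htp :> sq0 C -> sq1 D;
  htpM : forall x y, htp (x * y) = act (htp x) (mor0 g y) * htp y;
  bd_htp : forall x, bd (htp x) = (mor0 g x)^-1 * mor0 f x;
  htp_bd : forall a, htp (bd a) = (mor1 g a)^-1 * mor1 f a }.

Section Homotopies.
Implicit Types C D E : sqmod.

Lemma homotopy_eq C D (f g : sqmor C D) (s t : homotopy f g) :
  (forall x, s x = t x) -> s = t.
Proof.
case: s => s s1 s2 s3; case: t => t t1 t2 t3 /= /funext e; subst t.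
by rewrite (Prop_irrelevance s1 t1) (Prop_irrelevance s2 t2)
           (Prop_irrelevance s3 t3).
Qed.

Lemma htp_nat C D (f g : sqmor C D) (s : homotopy f g) x a :
  mor1 g a * s (x * bd a) = s x * mor1 f a.
Proof.
by rewrite htpM htp_bd mor_bd act_bd /conjg !mulgA mulgV mul1g mulgK.
Qed.

Program Definition homotopy_id C D (f : sqmor C D) : homotopy f f :=
  @Homotopy C D f f (fun _ => 1) _ _ _.
Next Obligation. by move=> C D f x y /=; rewrite act1 mulg1. Qed.
Next Obligation. by move=> C D f x /=; rewrite gmulf1 mulVg. Qed.
Next Obligation. by move=> C D f a /=; rewrite mulVg. Qed.

Program Definition homotopy_comp C D (f g h : sqmor C D)
    (t : homotopy g h) (s : homotopy f g) : homotopy f h :=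
  @Homotopy C D f h (fun x => t x * s x) _ _ _.
Next Obligation.
move=> C D f g h t s x y /=; rewrite !htpM actM.
have -> : mor0 g y = mor0 h y * bd (t y) by rewrite bd_htp mulVKg.
by rewrite act_mul act_bd /conjg !mulgA mulgK.
Qed.
Next Obligation.
by move=> C D f g h t s x /=; rewrite gmulfM !bd_htp !mulgA mulgK.
Qed.
Next Obligation.
by move=> C D f g h t s a /=; rewrite !htp_bd !mulgA mulgK.
Qed.

Lemma homotopy_compA C D (f g h k : sqmor C D)
  (u : homotopy h k) (t : homotopy g h) (s : homotopy f g) :
  homotopy_comp u (homotopy_comp t s) = homotopy_comp (homotopy_comp u t) s.
Proof. by apply: homotopy_eq => x /=; rewrite mulgA. Qed.

Lemma homotopy_comp1m C D (f g : sqmor C D) (s : homotopy f g) :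
  homotopy_comp (homotopy_id g) s = s.
Proof. by apply: homotopy_eq => x /=; rewrite mul1g. Qed.

Lemma homotopy_compm1 C D (f g : sqmor C D) (s : homotopy f g) :
  homotopy_comp s (homotopy_id f) = s.
Proof. by apply: homotopy_eq => x /=; rewrite mulg1. Qed.

Definition sqhom C D : category :=
  Category (@homotopy_compA C D) (@homotopy_comp1m C D) (@homotopy_compm1 C D).

Program Definition whisker_r C D E (g g' : sqmor D E) (t : homotopy g g')
    (f : sqmor C D) : homotopy (sqmor_comp g f) (sqmor_comp g' f) :=
  @Homotopy C E (sqmor_comp g f) (sqmor_comp g' f) (fun x => t (mor0 f x)) _ _ _.
Next Obligation. by move=> C D E g g' t f x y /=; rewrite gmulfM htpM. Qed.
Next Obligation. by move=> C D E g g' t f x /=; rewrite bd_htp. Qed.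
Next Obligation. by move=> C D E g g' t f a /=; rewrite mor_bd htp_bd. Qed.

Program Definition whisker_l C D E (g : sqmor D E) (f f' : sqmor C D)
    (s : homotopy f f') : homotopy (sqmor_comp g f) (sqmor_comp g f') :=
  @Homotopy C E (sqmor_comp g f) (sqmor_comp g f') (fun x => mor1 g (s x)) _ _ _.
Next Obligation.
by move=> C D E g f f' s x y /=; rewrite htpM gmulfM mor_act.
Qed.
Next Obligation.
by move=> C D E g f f' s x /=; rewrite -mor_bd bd_htp gmulfM gmulfV.
Qed.
Next Obligation.
by move=> C D E g f f' s a /=; rewrite htp_bd gmulfM gmulfV.
Qed.

(* On identity 2-morphisms this restricts to the composition of maps:
   the homotopies t * idm f and idm g * s are t \o f and g \o s. *)
Definition homotopy_hcomp C D E (g g' : sqmor D E) (f f' : sqmor C D)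
    (t : homotopy g g') (s : homotopy f f') :
    homotopy (sqmor_comp g f) (sqmor_comp g' f') :=
  homotopy_comp (whisker_r t f') (whisker_l g s).

Lemma homotopy_arrow_eq C D (f g f' g' : sqmor C D)
    (s : homotopy f g) (s' : homotopy f' g') :
  f = f' -> g = g' -> (forall x, s x = s' x) ->
  @mkarrow (sqhom C D) f g s = @mkarrow (sqhom C D) f' g' s'.
Proof. by move=> ef eg; subst f' g' => /homotopy_eq ->. Qed.

Lemma homotopy_hcomp1 C D E (g : sqmor D E) (f : sqmor C D) :
  homotopy_hcomp (homotopy_id g) (homotopy_id f) = homotopy_id (sqmor_comp g f).
Proof. by apply: homotopy_eq => x /=; rewrite gmulf1 mulg1. Qed.

Lemma homotopy_hcompM C D E (g g' g'' : sqmor D E) (f f' f'' : sqmor C D)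
    (t' : homotopy g' g'') (t : homotopy g g')
    (s' : homotopy f' f'') (s : homotopy f f') :
  homotopy_hcomp (homotopy_comp t' t) (homotopy_comp s' s) =
  homotopy_comp (homotopy_hcomp t' s') (homotopy_hcomp t s).
Proof.
apply: homotopy_eq => x /=; rewrite gmulfM -!mulgA; congr (_ * _).
rewrite !mulgA; congr (_ * _); rewrite -htp_nat bd_htp mulVKg //.
Qed.

Lemma sqmor_compA B C D E (h : sqmor D E) (g : sqmor C D) (f : sqmor B C) :
  sqmor_comp h (sqmor_comp g f) = sqmor_comp (sqmor_comp h g) f.
Proof. exact: sqmor_eq. Qed.

Lemma sqmor_comp_idl C D (f : sqmor C D) : sqmor_comp (sqmor_id D) f = f.
Proof. exact: sqmor_eq. Qed.

Lemma sqmor_comp_idr C D (f : sqmor C D) : sqmor_comp f (sqmor_id C) = f.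
Proof. exact: sqmor_eq. Qed.

Lemma homotopy_hcompA B C D E (h h' : sqmor D E) (g g' : sqmor C D)
    (f f' : sqmor B C) (u : homotopy h h') (t : homotopy g g')
    (s : homotopy f f') :
  @mkarrow (sqhom B E) _ _ (homotopy_hcomp u (homotopy_hcomp t s)) =
  @mkarrow (sqhom B E) _ _ (homotopy_hcomp (homotopy_hcomp u t) s).
Proof.
apply: homotopy_arrow_eq => [||x /=]; try exact: sqmor_compA.
by rewrite gmulfM mulgA.
Qed.

Lemma homotopy_hcomp_idl C D (f f' : sqmor C D) (s : homotopy f f') :
  @mkarrow (sqhom C D) _ _ (homotopy_hcomp (homotopy_id (sqmor_id D)) s) =
  @mkarrow (sqhom C D) _ _ s.
Proof.
apply: homotopy_arrow_eq => [||x /=]; try exact: sqmor_comp_idl.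
by rewrite mul1g.
Qed.

Lemma homotopy_hcomp_idr C D (f f' : sqmor C D) (s : homotopy f f') :
  @mkarrow (sqhom C D) _ _ (homotopy_hcomp s (homotopy_id (sqmor_id C))) =
  @mkarrow (sqhom C D) _ _ s.
Proof.
apply: homotopy_arrow_eq => [||x /=]; try exact: sqmor_comp_idr.
by rewrite gmulf1 mulg1.
Qed.

End Homotopies.

Definition sqmod_twocat : twocat :=
  @TwoCat sqmod sqhom sqmor_id sqmor_comp homotopy_hcomp
    homotopy_hcomp1 homotopy_hcompM sqmor_compA sqmor_comp_idl sqmor_comp_idr
    homotopy_hcompA homotopy_hcomp_idl homotopy_hcomp_idr.

(* The letters (true, e) and (false, e) stand for e and its inverse. *)
Definition word (E : Type) : Type := seq (bool * E).

HB.instance Definition _ (E : Type) := gen_eqMixin (word E).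
HB.instance Definition _ (E : Type) := gen_choiceMixin (word E).

Inductive word_equiv (E : Type) : word E -> word E -> Prop :=
| word_cancel u b e v : word_equiv (u ++ (b, e) :: (~~ b, e) :: v) (u ++ v)
| word_refl u : word_equiv u u
| word_sym u v : word_equiv u v -> word_equiv v u
| word_trans u v w : word_equiv u v -> word_equiv v w -> word_equiv u w.

Section FreeGroup.
Variable E : Type.
Implicit Types u v w : word E.

Definition word_rel : rel (word E) := fun u v => `[< word_equiv u v >].

Lemma word_rel_refl : reflexive word_rel.
Proof. by move=> u; apply/asboolP/word_refl. Qed.

Lemma word_rel_sym : symmetric word_rel.
Proof. by move=> u v; apply/asboolP/asboolP => /word_sym. Qed.

Lemma word_rel_trans : transitive word_rel.
Proof.
by move=> v u w /asboolP uv /asboolP vw; apply/asboolP/(word_trans uv).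
Qed.

Canonical word_equivRel :=
  EquivRel word_rel word_rel_refl word_rel_sym word_rel_trans.

Definition free_group := {eq_quot word_rel}.

HB.instance Definition _ := Choice.on free_group.

Definition free_pi (u : word E) : free_group := \pi_{eq_quot word_rel} u.
Definition free_repr (x : free_group) : word E := repr (x : {eq_quot word_rel}).

Lemma free_reprK x : free_pi (free_repr x) = x.
Proof. exact: reprK. Qed.

Lemma free_piP u v : free_pi u = free_pi v <-> word_equiv u v.
Proof.
split=> [/eqmodP /asboolP //|uv].
by apply/eqmodP/asboolP.
Qed.

Lemma word_equiv_cat u u' v v' :
  word_equiv u u' -> word_equiv v v' -> word_equiv (u ++ v) (u' ++ v').
Proof.
move=> uu' vv'; apply: (@word_trans _ _ (u' ++ v)).
  elim: uu' => {u u'} [u b e w|u|u w _|u w z _ IH1 _ IH2].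
  - by rewrite -!catA; apply: word_cancel.
  - exact: word_refl.
  - exact: word_sym.
  - exact: word_trans IH2.
elim: vv' => {v v'} [v b e w|v|v w _|v w z _ IH1 _ IH2].
- by rewrite !catA; apply: word_cancel.
- exact: word_refl.
- exact: word_sym.
- exact: word_trans IH2.
Qed.

Definition word_inv u : word E := rev [seq (~~ l.1, l.2) | l <- u].

Lemma word_invK u : word_inv (word_inv u) = u.
Proof.
rewrite /word_inv map_rev revK -map_comp -[RHS]map_id.
by apply: eq_map => -[b e] /=; rewrite negbK.
Qed.

Lemma word_equiv_inv u v : word_equiv u v -> word_equiv (word_inv u) (word_inv v).
Proof.
elim=> {u v} [u b e w|u|u w _|u w z _ IH1 _ IH2].
- rewrite /word_inv !map_cat !rev_cat /= !rev_cons -!cats1 -!catA /=.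
  by have := word_cancel (word_inv w) (~~ ~~ b) e (word_inv u); rewrite !negbK.
- exact: word_refl.
- exact: word_sym.
- exact: word_trans IH2.
Qed.

Lemma word_equivVl u : word_equiv (word_inv u ++ u) [::].
Proof.
elim: u => [|[b e] u IH]; first exact: word_refl.
rewrite /word_inv /= rev_cons -cats1 -catA /=.
apply: word_trans IH.
by have := word_cancel (word_inv u) (~~ b) e u; rewrite negbK.
Qed.

Lemma word_equivVr u : word_equiv (u ++ word_inv u) [::].
Proof. by have := word_equivVl (word_inv u); rewrite word_invK. Qed.

Definition free_mul (x y : free_group) := free_pi (free_repr x ++ free_repr y).
Definition free_one := free_pi [::].
Definition free_inv (x : free_group) := free_pi (word_inv (free_repr x)).

Lemma free_repr_pi u : word_equiv (free_repr (free_pi u)) u.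
Proof. by apply/free_piP; rewrite free_reprK. Qed.

Lemma free_mulA : associative free_mul.
Proof.
move=> x y z; apply/free_piP.
apply: (@word_trans _ _ (free_repr x ++ free_repr y ++ free_repr z)).
  by apply: word_equiv_cat; [exact: word_refl | exact: free_repr_pi].
rewrite catA; apply: word_sym.
by apply: word_equiv_cat; [exact: free_repr_pi | exact: word_refl].
Qed.

Lemma free_mul1g : left_id free_one free_mul.
Proof.
move=> x; rewrite -[RHS]free_reprK; apply/free_piP.
by apply: (word_equiv_cat (free_repr_pi [::])); exact: word_refl.
Qed.

Lemma free_mulg1 : right_id free_one free_mul.
Proof.
move=> x; rewrite -[RHS]free_reprK; apply/free_piP.
rewrite -[X in word_equiv _ X]cats0.
by apply: word_equiv_cat; [exact: word_refl | exact: free_repr_pi].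
Qed.

Lemma free_mulVg : left_inverse free_one free_inv free_mul.
Proof.
move=> x; apply/free_piP; apply: word_trans (word_equivVl (free_repr x)).
by apply: word_equiv_cat; [exact: free_repr_pi | exact: word_refl].
Qed.

Lemma free_mulgV : right_inverse free_one free_inv free_mul.
Proof.
move=> x; apply/free_piP; apply: word_trans (word_equivVr (free_repr x)).
by apply: word_equiv_cat; [exact: word_refl | exact: free_repr_pi].
Qed.

HB.instance Definition _ := isGroup.Build free_group
  free_mulA free_mul1g free_mulg1 free_mulVg free_mulgV.

End FreeGroup.

(* The normal subgroup generated by the triple commutators. *)
Inductive triple_commg (G : groupType) : G -> Prop :=
| tcommg_comm x y z : triple_commg [~ [~ x, y], z]
| tcommg_one : triple_commg 1
| tcommg_mul x y : triple_commg x -> triple_commg y -> triple_commg (x * y)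
| tcommg_inv x : triple_commg x -> triple_commg x^-1
| tcommg_conj x y : triple_commg x -> triple_commg (x ^ y).

(* G is the quotient of the free group on some set by the triple commutators. *)
Definition free_nil2 (G : groupType) : Prop :=
  exists (E : Type) (q : UMagmaMorphism.type (free_group E) G),
    (forall y, exists x, q x = y) /\ (forall x, q x = 1 <-> triple_commg x).

Definition zero_free (C : sqmod_twocat) : Prop := free_nil2 (sq0 C).

(* Symmetric monoidal groupoids.  The constraints asc, lunit, runit and braid
   are isomorphisms by grp_iso. *)
Record symmon := SymMon {
  grp :> category;
  grp_iso : forall (x y : grp) (f : hom x y), is_iso f;
  munit : grp;
  ten : grp -> grp -> grp;
  tenm : forall x x' y y' : grp,
    hom x x' -> hom y y' -> hom (ten x y) (ten x' y');
  tenm1 : forall x y, tenm (idm x) (idm y) = idm (ten x y);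
  tenmM : forall x x' x'' y y' y'' (f' : hom x' x'') (f : hom x x')
      (g' : hom y' y'') (g : hom y y'),
    tenm (f' \oc f) (g' \oc g) = tenm f' g' \oc tenm f g;
  asc : forall x y z, hom (ten (ten x y) z) (ten x (ten y z));
  lunit : forall x, hom (ten munit x) x;
  runit : forall x, hom (ten x munit) x;
  braid : forall x y, hom (ten x y) (ten y x);
  asc_nat : forall x x' y y' z z' (f : hom x x') (g : hom y y') (h : hom z z'),
    asc x' y' z' \oc tenm (tenm f g) h = tenm f (tenm g h) \oc asc x y z;
  lunit_nat : forall x x' (f : hom x x'), lunit x' \oc tenm (idm munit) f = f \oc lunit x;
  runit_nat : forall x x' (f : hom x x'), runit x' \oc tenm f (idm munit) = f \oc runit x;
  braid_nat : forall x x' y y' (f : hom x x') (g : hom y y'),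
    braid x' y' \oc tenm f g = tenm g f \oc braid x y;
  pentagon : forall w x y z,
    asc w x (ten y z) \oc asc (ten w x) y z =
    tenm (idm w) (asc x y z) \oc asc w (ten x y) z \oc tenm (asc w x y) (idm z);
  triangle : forall x y,
    tenm (idm x) (lunit y) \oc asc x munit y = tenm (runit x) (idm y);
  hexagon : forall x y z,
    asc y z x \oc braid x (ten y z) \oc asc x y z =
    tenm (idm y) (braid x z) \oc asc y x z \oc tenm (braid x y) (idm z);
  braidK : forall x y, braid y x \oc braid x y = idm (ten x y) }.

Arguments munit : clear implicits.

Program Definition ten_functor (P : symmon) (x : P) : functor P P :=
  @Functor P P (ten x) (fun y y' g => tenm (idm x) g) _ _.
Next Obligation. by move=> P x y /=; rewrite tenm1. Qed.
Next Obligation. by move=> P x y y' y'' g f /=; rewrite -tenmM cmp1m. Qed.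

Record picard := Picard {
  pic :> symmon;
  pic_ten : forall x : pic, is_equivalence (ten_functor x) }.

(* Symmetric tensor functors.  Since Q is a groupoid, tmul and tunit are
   isomorphisms. *)
Record tensor_functor (P Q : picard) := TensorFunctor {
  tfun :> functor P Q;
  tmul : forall x y, hom (ten (tfun x) (tfun y)) (tfun (ten x y));
  tunit : hom (munit Q) (tfun (munit P));
  tmul_nat : forall x x' y y' (f : hom x x') (g : hom y y'),
    tmul x' y' \oc tenm (fmap tfun f) (fmap tfun g) =
    fmap tfun (tenm f g) \oc tmul x y;
  tmul_asc : forall x y z,
    fmap tfun (asc x y z) \oc tmul (ten x y) z \oc tenm (tmul x y) (idm (tfun z)) =
    tmul x (ten y z) \oc tenm (idm (tfun x)) (tmul y z) \oc
      asc (tfun x) (tfun y) (tfun z);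
  tmul_lunit : forall x,
    fmap tfun (lunit x) \oc tmul (munit P) x \oc tenm tunit (idm (tfun x)) =
    lunit (tfun x);
  tmul_runit : forall x,
    fmap tfun (runit x) \oc tmul x (munit P) \oc tenm (idm (tfun x)) tunit =
    runit (tfun x);
  tmul_braid : forall x y,
    fmap tfun (braid x y) \oc tmul x y = tmul y x \oc braid (tfun x) (tfun y) }.

Arguments tmul {P Q} F x y : rename.
Arguments tunit {P Q} F : rename.

Record tensor_nat (P Q : picard) (F G : tensor_functor P Q) := TensorNat {
  tnat :> forall x, hom (F x) (G x);
  tnat_nat : forall x y (f : hom x y),
    tnat y \oc fmap F f = fmap G f \oc tnat x;
  tnat_mul : forall x y,
    tnat (ten x y) \oc tmul F x y = tmul G x y \oc tenm (tnat x) (tnat y);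
  tnat_unit : tnat (munit P) \oc tunit F = tunit G }.

Section PicardTheory.
Implicit Types P Q R S : picard.

Lemma tensor_functor_eq P Q (F G : tensor_functor P Q) (e : fob F = fob G) :
  (forall x y (f : hom x y), mkarrow (fmap F f) = mkarrow (fmap G f)) ->
  (forall x y, mkarrow (tmul F x y) = mkarrow (tmul G x y)) ->
  mkarrow (tunit F) = mkarrow (tunit G) -> F = G.
Proof.
case: F e => [[F Fm F1 FM] m u p1 p2 p3 p4 p5] /=.
case: G => [[G Gm G1 GM] m' u' q1 q2 q3 q4 q5] /= e; subst G => em emul eu.
have e1 : Fm = Gm.
  by do 3![apply: functional_extensionality_dep => ?]; apply: mkarrow_inj.
subst Gm.
have e2 : m = m'.
  by do 2![apply: functional_extensionality_dep => ?]; apply: mkarrow_inj.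
have e3 : u = u' by apply: mkarrow_inj.
have e4 : F1 = G1 by apply: Prop_irrelevance.
have e5 : FM = GM by apply: Prop_irrelevance.
subst m' u' G1 GM.
by congr TensorFunctor; apply: Prop_irrelevance.
Qed.

Lemma tensor_nat_eq P Q (F G : tensor_functor P Q) (s t : tensor_nat F G) :
  (forall x, s x = t x) -> s = t.
Proof.
case: s => s s1 s2 s3; case: t => t t1 t2 t3 /= e.
have {}e : s = t by apply: functional_extensionality_dep.
by subst t; congr TensorNat; apply: Prop_irrelevance.
Qed.

Program Definition tensor_functor_id P : tensor_functor P P :=
  @TensorFunctor P P (functor_id P)
    (fun x y => idm (ten x y)) (idm (munit P)) _ _ _ _ _.
Next Obligation. by move=> P x x' y y' f g /=; rewrite cmp1m cmpm1. Qed.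
Next Obligation. by move=> P x y z /=; rewrite !tenm1 !cmpm1 !cmp1m. Qed.
Next Obligation. by move=> P x /=; rewrite tenm1 !cmpm1. Qed.
Next Obligation. by move=> P x /=; rewrite tenm1 !cmpm1. Qed.
Next Obligation. by move=> P x y /=; rewrite cmp1m cmpm1. Qed.

Lemma tenm_cmpl (P : symmon) (x x' x'' y : P) (f' : hom x' x'') (f : hom x x') :
  tenm (f' \oc f) (idm y) = tenm f' (idm y) \oc tenm f (idm y).
Proof. by rewrite -tenmM cmp1m. Qed.

Lemma tenm_cmpr (P : symmon) (x y y' y'' : P) (f' : hom y' y'') (f : hom y y') :
  tenm (idm x) (f' \oc f) = tenm (idm x) f' \oc tenm (idm x) f.
Proof. by rewrite -tenmM cmp1m. Qed.

Lemma tmul_natl P Q (F : tensor_functor P Q) (x x' y : P) (f : hom x x') :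
  tmul F x' y \oc tenm (fmap F f) (idm (F y)) =
  fmap F (tenm f (idm y)) \oc tmul F x y.
Proof. by rewrite -fmap1 tmul_nat. Qed.

Lemma tmul_natr P Q (F : tensor_functor P Q) (x y y' : P) (g : hom y y') :
  tmul F x y' \oc tenm (idm (F x)) (fmap F g) =
  fmap F (tenm (idm x) g) \oc tmul F x y.
Proof. by rewrite -fmap1 tmul_nat. Qed.

Program Definition tensor_functor_comp P Q R
    (G : tensor_functor Q R) (F : tensor_functor P Q) : tensor_functor P R :=
  @TensorFunctor P R (functor_comp G F)
    (fun x y => fmap G (tmul F x y) \oc tmul G (F x) (F y))
    (fmap G (tunit F) \oc tunit G) _ _ _ _ _.
Next Obligation.
move=> P Q R G F x x' y y' f g /=.
by rewrite -cmpA tmul_nat !cmpA -!fmapM tmul_nat.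
Qed.
Next Obligation.
move=> P Q R G F x y z /=.
rewrite tenm_cmpl tenm_cmpr !cmpA -!fmapM.
rewrite -[X in X \oc _ = _]cmpA tmul_natl !cmpA -!fmapM tmul_asc.
rewrite -[X in _ = X \oc _ \oc _]cmpA tmul_natr !cmpA -!fmapM !fmapM.
by rewrite -!cmpA; do 2!congr (_ \oc _); rewrite !cmpA tmul_asc.
Qed.
Next Obligation.
move=> P Q R G F x /=.
rewrite tenm_cmpl !cmpA -!fmapM.
rewrite -[X in X \oc _ = _]cmpA tmul_natl !cmpA -!fmapM tmul_lunit.
exact: tmul_lunit.
Qed.
Next Obligation.
move=> P Q R G F x /=.
rewrite tenm_cmpr !cmpA -!fmapM.
rewrite -[X in X \oc _ = _]cmpA tmul_natr !cmpA -!fmapM tmul_runit.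
exact: tmul_runit.
Qed.
Next Obligation.
move=> P Q R G F x y /=.
by rewrite !cmpA -!fmapM tmul_braid fmapM -cmpA tmul_braid cmpA.
Qed.

Program Definition tensor_nat_id P Q (F : tensor_functor P Q) : tensor_nat F F :=
  @TensorNat P Q F F (fun x => idm (F x)) _ _ _.
Next Obligation. by move=> P Q F x y f /=; rewrite cmp1m cmpm1. Qed.
Next Obligation. by move=> P Q F x y /=; rewrite tenm1 cmp1m cmpm1. Qed.
Next Obligation. by move=> P Q F /=; rewrite cmp1m. Qed.

Program Definition tensor_nat_comp P Q (F G H : tensor_functor P Q)
    (t : tensor_nat G H) (s : tensor_nat F G) : tensor_nat F H :=
  @TensorNat P Q F H (fun x => t x \oc s x) _ _ _.
Next Obligation.
by move=> P Q F G H t s x y f /=; rewrite -cmpA tnat_nat !cmpA tnat_nat.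
Qed.
Next Obligation.
by move=> P Q F G H t s x y /=; rewrite -cmpA tnat_mul !cmpA tnat_mul tenmM !cmpA.
Qed.
Next Obligation.
by move=> P Q F G H t s /=; rewrite -cmpA !tnat_unit.
Qed.

Lemma tensor_nat_compA P Q (F G H K : tensor_functor P Q)
    (u : tensor_nat H K) (t : tensor_nat G H) (s : tensor_nat F G) :
  tensor_nat_comp u (tensor_nat_comp t s) = tensor_nat_comp (tensor_nat_comp u t) s.
Proof. by apply: tensor_nat_eq => x /=; rewrite cmpA. Qed.

Lemma tensor_nat_comp1m P Q (F G : tensor_functor P Q) (s : tensor_nat F G) :
  tensor_nat_comp (tensor_nat_id G) s = s.
Proof. by apply: tensor_nat_eq => x /=; rewrite cmp1m. Qed.

Lemma tensor_nat_compm1 P Q (F G : tensor_functor P Q) (s : tensor_nat F G) :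
  tensor_nat_comp s (tensor_nat_id F) = s.
Proof. by apply: tensor_nat_eq => x /=; rewrite cmpm1. Qed.

Definition tensor_hom P Q : category :=
  Category (@tensor_nat_compA P Q) (@tensor_nat_comp1m P Q)
           (@tensor_nat_compm1 P Q).

Program Definition tensor_nat_hcomp P Q R (G G' : tensor_functor Q R)
    (F F' : tensor_functor P Q) (t : tensor_nat G G') (s : tensor_nat F F') :
    tensor_nat (tensor_functor_comp G F) (tensor_functor_comp G' F') :=
  @TensorNat P R (tensor_functor_comp G F) (tensor_functor_comp G' F')
    (fun x => t (F' x) \oc fmap G (s x)) _ _ _.
Next Obligation.
move=> P Q R G G' F F' t s x y f /=.
by rewrite -cmpA -fmapM (tnat_nat s) fmapM !cmpA (tnat_nat t).
Qed.
Next Obligation.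
move=> P Q R G G' F F' t s x y /=.
rewrite tenmM !cmpA -[X in X \oc _ = _]cmpA -fmapM tnat_mul fmapM !cmpA.
rewrite tnat_nat -[LHS]cmpA -[in LHS]tmul_nat !cmpA.
by congr (_ \oc _); rewrite -!cmpA tnat_mul.
Qed.
Next Obligation.
move=> P Q R G G' F F' t s /=.
by rewrite !cmpA -[X in X \oc _ = _]cmpA -fmapM tnat_unit tnat_nat -cmpA tnat_unit.
Qed.

Lemma tensor_arrow_eq P Q (F G F' G' : tensor_functor P Q)
    (s : tensor_nat F G) (s' : tensor_nat F' G') :
  F = F' -> G = G' -> (forall x, mkarrow (s x) = mkarrow (s' x)) ->
  @mkarrow (tensor_hom P Q) F G s = @mkarrow (tensor_hom P Q) F' G' s'.
Proof.
move=> eF eG; subst F' G' => e; congr mkarrow.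
by apply: tensor_nat_eq => x; apply: mkarrow_inj.
Qed.

Lemma tensor_functor_compA P Q R S (H : tensor_functor R S)
    (G : tensor_functor Q R) (F : tensor_functor P Q) :
  tensor_functor_comp H (tensor_functor_comp G F) =
  tensor_functor_comp (tensor_functor_comp H G) F.
Proof.
by apply: tensor_functor_eq => //= *; congr mkarrow; rewrite fmapM cmpA.
Qed.

Lemma tensor_functor_comp_idl P Q (F : tensor_functor P Q) :
  tensor_functor_comp (tensor_functor_id Q) F = F.
Proof.
by apply: tensor_functor_eq => //= *; congr mkarrow; rewrite cmpm1.
Qed.

Lemma tensor_functor_comp_idr P Q (F : tensor_functor P Q) :
  tensor_functor_comp F (tensor_functor_id P) = F.
Proof.
by apply: tensor_functor_eq => //= *; congr mkarrow; rewrite fmap1 cmp1m.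
Qed.

Lemma tensor_nat_hcomp1 P Q R (G : tensor_functor Q R) (F : tensor_functor P Q) :
  tensor_nat_hcomp (tensor_nat_id G) (tensor_nat_id F) =
  tensor_nat_id (tensor_functor_comp G F).
Proof. by apply: tensor_nat_eq => x /=; rewrite fmap1 cmpm1. Qed.

Lemma tensor_nat_hcompM P Q R (G G' G'' : tensor_functor Q R)
    (F F' F'' : tensor_functor P Q) (t' : tensor_nat G' G'') (t : tensor_nat G G')
    (s' : tensor_nat F' F'') (s : tensor_nat F F') :
  tensor_nat_hcomp (tensor_nat_comp t' t) (tensor_nat_comp s' s) =
  tensor_nat_comp (tensor_nat_hcomp t' s') (tensor_nat_hcomp t s).
Proof.
apply: tensor_nat_eq => x /=; rewrite fmapM -!cmpA; congr (_ \oc _).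
by rewrite !cmpA tnat_nat.
Qed.

Lemma tensor_nat_hcompA P Q R S (H H' : tensor_functor R S)
    (G G' : tensor_functor Q R) (F F' : tensor_functor P Q)
    (u : tensor_nat H H') (t : tensor_nat G G') (s : tensor_nat F F') :
  @mkarrow (tensor_hom P S) _ _ (tensor_nat_hcomp u (tensor_nat_hcomp t s)) =
  @mkarrow (tensor_hom P S) _ _ (tensor_nat_hcomp (tensor_nat_hcomp u t) s).
Proof.
apply: tensor_arrow_eq => [||x /=]; try exact: tensor_functor_compA.
by rewrite fmapM cmpA.
Qed.

Lemma tensor_nat_hcomp_idl P Q (F F' : tensor_functor P Q) (s : tensor_nat F F') :
  @mkarrow (tensor_hom P Q) _ _
    (tensor_nat_hcomp (tensor_nat_id (tensor_functor_id Q)) s) =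
  @mkarrow (tensor_hom P Q) _ _ s.
Proof.
apply: tensor_arrow_eq => [||x /=]; try exact: tensor_functor_comp_idl.
by rewrite cmp1m.
Qed.

Lemma tensor_nat_hcomp_idr P Q (F F' : tensor_functor P Q) (s : tensor_nat F F') :
  @mkarrow (tensor_hom P Q) _ _
    (tensor_nat_hcomp s (tensor_nat_id (tensor_functor_id P))) =
  @mkarrow (tensor_hom P Q) _ _ s.
Proof.
apply: tensor_arrow_eq => [||x /=]; try exact: tensor_functor_comp_idr.
by rewrite fmap1 cmpm1.
Qed.

End PicardTheory.

Definition picard_twocat : twocat :=
  @TwoCat picard tensor_hom tensor_functor_id tensor_functor_comp
    tensor_nat_hcomp tensor_nat_hcomp1 tensor_nat_hcompM
    tensor_functor_compA tensor_functor_comp_idl tensor_functor_comp_idr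
    tensor_nat_hcompA tensor_nat_hcomp_idl tensor_nat_hcomp_idr.

(* [GHom a e : ghom x y] is the morphism (y, a) : y * bd a -> y; the equation
   e : x = y * bd a spares transports along equalities of objects. *)
Record ghom (C : sqmod) (x y : sq0 C) := GHom {
  gval :> sq1 C;
  gvalP : x = y * bd gval }.

Section Gamma.
Variable C : sqmod.
Implicit Types (x y z : sq0 C).

Lemma ghom_eq x y (f g : ghom x y) : gval f = gval g -> f = g.
Proof.
case: f => a ea; case: g => b eb /= e; subst b.
by rewrite (Prop_irrelevance ea eb).
Qed.

Lemma gid_subproof x y : x = y -> x = y * bd (1 : sq1 C).
Proof. by move->; rewrite gmulf1 mulg1. Qed.

(* The identity morphism of x, with target y = x. *)
Definition geq x y (e : x = y) : ghom x y := GHom (gid_subproof e).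

Lemma gcmp_subproof x y z (g : ghom y z) (f : ghom x y) :
  x = z * bd (gval g * gval f).
Proof. by rewrite gmulfM mulgA -gvalP -gvalP. Qed.

Definition gcmp x y z (g : ghom y z) (f : ghom x y) : ghom x z :=
  GHom (gcmp_subproof g f).

Lemma gcmpA w x y z (h : ghom y z) (g : ghom x y) (f : ghom w x) :
  gcmp h (gcmp g f) = gcmp (gcmp h g) f.
Proof. by apply: ghom_eq; rewrite /= mulgA. Qed.

Lemma gcmp1m x y (f : ghom x y) : gcmp (geq erefl) f = f.
Proof. by apply: ghom_eq; rewrite /= mul1g. Qed.

Lemma gcmpm1 x y (f : ghom x y) : gcmp f (geq erefl) = f.
Proof. by apply: ghom_eq; rewrite /= mulg1. Qed.

Definition gamma_cat : category :=
  @Category (sq0 C) (@ghom C) (fun x => geq erefl) gcmp gcmpA gcmp1m gcmpm1.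

Lemma ginv_subproof x y (f : ghom x y) : y = x * bd (gval f)^-1.
Proof. by rewrite {1}(gvalP f) gmulfV mulgK. Qed.

Lemma gamma_iso (x y : gamma_cat) (f : hom x y) : is_iso f.
Proof.
exists (GHom (ginv_subproof f)).
by split; apply: ghom_eq; rewrite /= ?mulVg ?mulgV.
Qed.

Lemma gten_subproof x x' y y' (f : ghom x x') (g : ghom y y') :
  x * y = (x' * y') * bd (act (gval f) y' * gval g).
Proof.
rewrite gmulfM bd_act {1}(gvalP f) {1}(gvalP g) /conjg.
by rewrite !mulgA mulgK.
Qed.

Definition gten x x' y y' (f : ghom x x') (g : ghom y y') :
    ghom (x * y) (x' * y') :=
  GHom (gten_subproof f g).

Lemma gsym_subproof x y : x * y = y * x * bd (brk y x).
Proof. by rewrite bd_brk commgC. Qed.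

Definition gsym x y : ghom (x * y) (y * x) := GHom (gsym_subproof x y).

Lemma gten_cmp x x' x'' y y' y'' (f' : ghom x' x'') (f : ghom x x')
    (g' : ghom y' y'') (g : ghom y y') :
  gten (gcmp f' f) (gcmp g' g) = gcmp (gten f' g') (gten f g).
Proof.
apply: ghom_eq => /=.
have -> : act (gval f) y' = act (gval f) (y'' * bd (gval g')) by rewrite -gvalP.
by rewrite act_mul act_bd actM /conjg !mulgA mulgK.
Qed.

Lemma brk_sym_nat x y a b :
  brk y x * (act a y * b) = act b x * a * brk (y * bd b) (x * bd a) :> sq1 C.
Proof.
rewrite brkMl !brkMr brk_bd /act [brk (bd b) x]brk_antiV.
set P := brk y x; set Q := brk y (bd a); set R := brk x (bd b).
have cP c : P * c = c * P := brk_central _ _ _.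
have cQ c : Q * c = c * Q := brk_central _ _ _.
have cR c : R * c = c * R := brk_central _ _ _.
have -> : a * Q = Q * a by rewrite cQ.
have e1 : b * R * a * P * Q = b * a * P * Q * R by rewrite -!mulgA cR !mulgA.
have e2 : b * a * P * Q = P * Q * b * a.
  by rewrite -cQ -(cP (b * a)) !mulgA (cQ P).
by rewrite /commg /conjg !mulgA e1 mulgK e2 !mulgK.
Qed.

Lemma gsym_nat x x' y y' (f : ghom x x') (g : ghom y y') :
  gcmp (gsym x' y') (gten f g) = gcmp (gten g f) (gsym x y).
Proof.
apply: ghom_eq => /=.
rewrite brk_sym_nat.
by rewrite -!gvalP.
Qed.

Program Definition gamma_symmon : symmon :=
  @SymMon gamma_cat gamma_iso (1 : sq0 C) (fun x y : sq0 C => x * y) gten _ _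
    (fun x y z => geq (esym (mulgA x y z)))
    (fun x => geq (mul1g x)) (fun x => geq (mulg1 x)) gsym
    _ _ _ _ _ _ _ _.
Next Obligation. by move=> x y; apply: ghom_eq; rewrite /= act1 mulg1. Qed.
Next Obligation. exact: gten_cmp. Qed.
Next Obligation.
move=> x x' y y' z z' f g h; apply: ghom_eq => /=.
rewrite mul1g mulg1 actM -act_mul; exact: esym (mulgA _ _ _).
Qed.
Next Obligation.
by move=> x x' f; apply: ghom_eq; rewrite /= act1 !mul1g mulg1.
Qed.
Next Obligation.
by move=> x x' f; apply: ghom_eq; rewrite /= act_id mul1g.
Qed.
Next Obligation. exact: gsym_nat. Qed.
Next Obligation.
by move=> w x y z; apply: ghom_eq; rewrite /= !act1 !mulg1.
Qed.
Next Obligation.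
by move=> x y; apply: ghom_eq; rewrite /= !act1 !mulg1.
Qed.
Next Obligation.
move=> x y z; apply: ghom_eq; rewrite /= !act1 !mulg1 !mul1g act_brk.
by rewrite brkMl brkC.
Qed.
Next Obligation.
by move=> x y; apply: ghom_eq; rewrite /= brk_anti.
Qed.

Lemma gamma_ten (x : gamma_symmon) : is_equivalence (ten_functor x).
Proof.
exists (ten_functor (P := gamma_symmon) (x : sq0 C)^-1); split.
- exists (fun y => geq (mulKg (x : sq0 C) y)); split=> [y y' f|y].
    by apply: ghom_eq; rewrite /= !act1 !mul1g mulg1.
  exact: gamma_iso.
- exists (fun y => geq (mulVKg (x : sq0 C) y)); split=> [y y' f|y].
    by apply: ghom_eq; rewrite /= !act1 !mul1g mulg1.
  exact: gamma_iso.
Qed.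

Definition gamma_pic : picard := Picard gamma_ten.

End Gamma.

Section GammaMaps.
Implicit Types C D E : sqmod.

Lemma gmap_subproof C D (f : sqmor C D) x y (a : ghom x y) :
  mor0 f x = mor0 f y * bd (mor1 f (gval a)).
Proof. by rewrite {1}(gvalP a) gmulfM mor_bd. Qed.

Definition gmap C D (f : sqmor C D) x y (a : ghom x y) :
    ghom (mor0 f x) (mor0 f y) :=
  GHom (gmap_subproof f a).

Program Definition gamma_functor C D (f : sqmor C D) :
    functor (gamma_pic C) (gamma_pic D) :=
  @Functor (gamma_pic C) (gamma_pic D) (mor0 f) (@gmap C D f) _ _.
Next Obligation. by move=> C D f x; apply: ghom_eq; rewrite /= gmulf1. Qed.
Next Obligation.
by move=> C D f x y z b a; apply: ghom_eq; rewrite /= gmulfM.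
Qed.

Program Definition gamma_mor C D (f : sqmor C D) :
    tensor_functor (gamma_pic C) (gamma_pic D) :=
  @TensorFunctor (gamma_pic C) (gamma_pic D) (gamma_functor f)
    (fun x y => geq (esym (@gmulfM _ _ (mor0 f) x y)))
    (geq (esym (@gmulf1 _ _ (mor0 f))))
    _ _ _ _ _.
Next Obligation.
move=> C D f x x' y y' a b; apply: ghom_eq => /=.
by rewrite mul1g mulg1 gmulfM mor_act.
Qed.
Next Obligation.
by move=> C D f x y z; apply: ghom_eq; rewrite /= gmulf1 !act1 !mulg1.
Qed.
Next Obligation.
by move=> C D f x; apply: ghom_eq; rewrite /= gmulf1 !act1 !mulg1.
Qed.
Next Obligation.
by move=> C D f x; apply: ghom_eq; rewrite /= gmulf1 !act1 !mulg1.
Qed.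
Next Obligation.
by move=> C D f x y; apply: ghom_eq; rewrite /= mor_brk mul1g mulg1.
Qed.

Lemma gamma_htp_subproof C D (f g : sqmor C D) (s : homotopy f g) x :
  mor0 f x = mor0 g x * bd (s x).
Proof. by rewrite bd_htp mulVKg. Qed.

Program Definition gamma_htp C D (f g : sqmor C D) (s : homotopy f g) :
    tensor_nat (gamma_mor f) (gamma_mor g) :=
  @TensorNat (gamma_pic C) (gamma_pic D) (gamma_mor f) (gamma_mor g)
    (fun x => GHom (gamma_htp_subproof s x)) _ _ _.
Next Obligation.
move=> C D f g s x y a; apply: ghom_eq => /=.
by rewrite -htp_nat -gvalP.
Qed.
Next Obligation.
by move=> C D f g s x y; apply: ghom_eq; rewrite /= mul1g mulg1 htpM.
Qed.
Next Obligation.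
move=> C D f g s; apply: ghom_eq; rewrite /= mulg1.
apply: (@mulgI _ (s 1)); rewrite mulg1.
by rewrite -[X in _ = s X]mulg1 htpM gmulf1 act_id.
Qed.

Program Definition gamma_hom C D :
    functor (sqhom C D) (tensor_hom (gamma_pic C) (gamma_pic D)) :=
  @Functor (sqhom C D) (tensor_hom (gamma_pic C) (gamma_pic D))
    (@gamma_mor C D) (@gamma_htp C D) _ _.
Next Obligation.
by move=> C D f; apply: tensor_nat_eq => x; apply: ghom_eq.
Qed.
Next Obligation.
by move=> C D f g h t s; apply: tensor_nat_eq => x; apply: ghom_eq.
Qed.

Lemma gamma_mor_id C : gamma_mor (sqmor_id C) = tensor_functor_id (gamma_pic C).
Proof.
by apply: tensor_functor_eq => //= *; congr mkarrow; apply: ghom_eq.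
Qed.

Lemma gamma_mor_comp C D E (g : sqmor D E) (f : sqmor C D) :
  gamma_mor (sqmor_comp g f) = tensor_functor_comp (gamma_mor g) (gamma_mor f).
Proof.
by apply: tensor_functor_eq => //= *; congr mkarrow; apply: ghom_eq;
   rewrite //= gmulf1 mulg1.
Qed.

Lemma gamma_htp_hcomp C D E (g g' : sqmor D E) (f f' : sqmor C D)
    (t : homotopy g g') (s : homotopy f f') :
  @mkarrow (tensor_hom (gamma_pic C) (gamma_pic E)) _ _
    (gamma_htp (homotopy_hcomp t s)) =
  @mkarrow (tensor_hom (gamma_pic C) (gamma_pic E)) _ _
    (tensor_nat_hcomp (gamma_htp t) (gamma_htp s)).
Proof.
apply: tensor_arrow_eq => [||x]; try exact: gamma_mor_comp.
by congr mkarrow; apply: ghom_eq.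
Qed.

End GammaMaps.

Definition Gamma : twofunctor sqmod_twocat picard_twocat :=
  @TwoFunctor sqmod_twocat picard_twocat gamma_pic gamma_hom
    gamma_mor_id gamma_mor_comp gamma_htp_hcomp.

(* Main.v *)
(** Full faithfulness on 2-morphisms is immediate: a tensor transformation
    between strict functors is the same thing as a homotopy.

    A symmetric tensor functor F from Gamma C to Gamma D is strictified on the
    group of pairs (x, d) formed by an object x of C and an isomorphism d onto
    F x.  Since F is symmetric, the commutators of this group are given by the
    brackets of C and D, so that it is nilpotent of class 2 and the projection
    to C_0 has a section as soon as C_0 is 0-free.  The section is the
    isomorphism between F and a strict functor.

    Given a Picard groupoid P, let G be the free group on its objects.  A
    measure of the morphisms of P by the scalars A = Aut(1) turns the
    associativity and the symmetry of P into a cocycle on the group of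
    isomorphism classes.  The associativity part is killed on G, because
    H^3 (G, A) = 0, and what is left of P is a function gam : G * G -> A, the
    braiding of a strict symmetric monoidal structure on G.  Sorting the
    letters of a word by braidings yields psi : [G, G] -> A, which trivializes
    gam on triple commutators; hence the strict model descends to the quotient
    of G by the triple commutators, where gam becomes biadditive, and this is
    the stable quadratic module sought. *)

From HB Require Import structures.
From mathcomp Require Import all_boot boolp wochoice.
Require Import Defs.
Set Implicit Arguments.
Unset Strict Implicit.
Unset Printing Implicit Defensive.
Import Algebra.
Local Open Scope ring_scope.
Local Open Scope group_scope.
Local Open Scope quotient_scope.
Local Open Scope cat_scope.
Local Obligation Tactic := try by [].

(** * Groups *)

Inductive aterm := AVar of nat | AZero | AOpp of aterm | AAdd of aterm & aterm.

Fixpoint aden (V : zmodType) (env : seq V) (t : aterm) : V :=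
  match t with
  | AVar i => nth 0%R env i
  | AZero => 0%R
  | AOpp t => (- aden env t)%R
  | AAdd t u => (aden env t + aden env u)%R
  end.

Fixpoint avars (b : bool) (t : aterm) : seq nat :=
  match t with
  | AVar i => if b then [:: i] else [::]
  | AZero => [::]
  | AOpp t => avars (~~ b) t
  | AAdd t u => avars b t ++ avars b u
  end.

Definition asum (V : zmodType) (env : seq V) (s : seq nat) : V :=
  (\sum_(i <- s) nth 0 env i)%R.

Lemma adenE (V : zmodType) (env : seq V) t :
  aden env t = (asum env (avars true t) - asum env (avars false t))%R.
Proof.
elim: t => [i||t IH|t IHt u IHu] /=.
- by rewrite /asum big_seq1 big_nil subr0.
- by rewrite /asum big_nil subr0.
- by rewrite IH opprB.
- by rewrite IHt IHu /asum !big_cat /= opprD addrACA.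
Qed.

(** Once the negated variables are moved to the other side, both members are sums over lists of
    indices, which agree when the lists are permutations of each other. The tactic [abel] checks
    this hypothesis by evaluation. *)
Lemma aden_eq (V : zmodType) (env : seq V) t u :
  perm_eq (avars true t ++ avars false u) (avars true u ++ avars false t) ->
  aden env t = aden env u.
Proof.
move=> p; rewrite !adenE; apply/eqP; rewrite subr_eq addrAC eq_sym subr_eq.
rewrite /asum -!big_cat /=; apply/eqP; symmetry; exact: perm_big.
Qed.

Ltac abel_index x env :=
  lazymatch env with
  | x :: _ => constr:(O)
  | _ :: ?env' => let n := abel_index x env' in constr:(S n)
  end.

Ltac abel_env t env :=
  lazymatch t with
  | (?a + ?b)%R => let env' := abel_env a env in abel_env b env'
  | (- ?a)%R => abel_env a env
  | 0%R => env
  | _ => lazymatch env with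
         | context [t :: _] => env
         | _ => constr:(t :: env)
         end
  end.

Ltac abel_term t env :=
  lazymatch t with
  | (?a + ?b)%R => let a' := abel_term a env in let b' := abel_term b env in
                   constr:(AAdd a' b')
  | (- ?a)%R => let a' := abel_term a env in constr:(AOpp a')
  | 0%R => constr:(AZero)
  | _ => let n := abel_index t env in constr:(AVar n)
  end.

Ltac abel :=
  lazymatch goal with
  | |- @eq ?V ?a ?b =>
    let env0 := abel_env a (@nil V) in
    let env := abel_env b env0 in
    let t := abel_term a env in
    let u := abel_term b env in
    exact (@aden_eq _ env t u isT)
  end.


(** * Quotient groups by a normal subgroup given as a predicate *)

Record normal_pred (G : groupType) := NormalPred {
  npred :> G -> Prop;
  npred1 : npred 1;
  npredM : forall x y, npred x -> npred y -> npred (x * y);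
  npredV : forall x, npred x -> npred x^-1;
  npredJ : forall x y, npred x -> npred (x ^ y) }.

Section QuotientGroup.
Variables (G : groupType) (N : normal_pred G).
Implicit Types x y z : G.

Definition coset_rel : rel G := fun x y => `[< N (x^-1 * y) >].

Lemma coset_rel_refl : reflexive coset_rel.
Proof. by move=> x; apply/asboolP; rewrite mulVg; apply: npred1. Qed.

Lemma coset_rel_sym : symmetric coset_rel.
Proof.
by move=> x y; apply/asboolP/asboolP => /npredV; rewrite invgM invgK.
Qed.

Lemma coset_rel_trans : transitive coset_rel.
Proof.
move=> y x z /asboolP xy /asboolP yz; apply/asboolP.
by have := npredM xy yz; rewrite !mulgA mulgK.
Qed.

Canonical coset_equivRel :=
  EquivRel coset_rel coset_rel_refl coset_rel_sym coset_rel_trans.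

Definition quot_group := {eq_quot coset_rel}.

HB.instance Definition _ := Choice.on quot_group.

Definition quot_pi (x : G) : quot_group := \pi_{eq_quot coset_rel} x.
Definition quot_repr (p : quot_group) : G := repr (p : {eq_quot coset_rel}).

Lemma quot_reprK p : quot_pi (quot_repr p) = p.
Proof. exact: reprK. Qed.

Lemma quot_piP x y : quot_pi x = quot_pi y <-> N (x^-1 * y).
Proof. by split=> [/eqmodP/asboolP|xy] //; apply/eqmodP/asboolP. Qed.

Lemma quot_repr_pi x : N (x^-1 * quot_repr (quot_pi x)).
Proof. by apply/quot_piP; rewrite quot_reprK. Qed.

Definition quot_mul p q := quot_pi (quot_repr p * quot_repr q).
Definition quot_one := quot_pi 1.
Definition quot_inv p := quot_pi (quot_repr p)^-1.

Lemma quot_mulE x y : quot_mul (quot_pi x) (quot_pi y) = quot_pi (x * y).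
Proof.
apply/esym/quot_piP.
have := npredM (npredJ y (quot_repr_pi x)) (quot_repr_pi y).
by rewrite /conjg !invgM !mulgA mulgK.
Qed.

Lemma quot_invE x : quot_inv (quot_pi x) = quot_pi x^-1.
Proof.
apply/esym/quot_piP; rewrite invgK.
have := npredJ x^-1 (npredV (quot_repr_pi x)).
by rewrite /conjg invgM !invgK !mulgA mulgK.
Qed.

Lemma quot_mulA : associative quot_mul.
Proof.
move=> p q r; rewrite -(quot_reprK p) -(quot_reprK q) -(quot_reprK r).
by rewrite !quot_mulE mulgA.
Qed.

Lemma quot_mul1g : left_id quot_one quot_mul.
Proof. by move=> p; rewrite -(quot_reprK p) quot_mulE mul1g. Qed.

Lemma quot_mulg1 : right_id quot_one quot_mul.
Proof. by move=> p; rewrite -(quot_reprK p) quot_mulE mulg1. Qed.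

Lemma quot_mulVg : left_inverse quot_one quot_inv quot_mul.
Proof. by move=> p; rewrite -(quot_reprK p) quot_invE quot_mulE mulVg. Qed.

Lemma quot_mulgV : right_inverse quot_one quot_inv quot_mul.
Proof. by move=> p; rewrite -(quot_reprK p) quot_invE quot_mulE mulgV. Qed.

HB.instance Definition _ := isGroup.Build quot_group
  quot_mulA quot_mul1g quot_mulg1 quot_mulVg quot_mulgV.

Lemma quot_pi_morph : monoid_morphism (quot_pi : G -> quot_group).
Proof. by split=> // x y; rewrite /= -quot_mulE. Qed.

HB.instance Definition _ :=
  isUMagmaMorphism.Build G quot_group quot_pi quot_pi_morph.

Lemma quot_pi_eq1 x : quot_pi x = 1 <-> N x.
Proof.
rewrite (_ : 1 = quot_pi 1) // quot_piP mulg1.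
by split=> /npredV; rewrite ?invgK.
Qed.

End QuotientGroup.

Section Descent.
Variables (F G H : groupType).
Variables (q : UMagmaMorphism.type F G) (f : UMagmaMorphism.type F H).
Hypotheses (q_surj : forall y, exists x, q x = y).
Hypothesis (fq : forall x, q x = 1 -> f x = 1).

Lemma descent : exists g : UMagmaMorphism.type G H, forall x, g (q x) = f x.
Proof.
pose g y := f (projT1 (cid (q_surj y))).
have gE x : g (q x) = f x.
  rewrite /g; case: cid => x' /= e.
  by apply/divg1_eq; rewrite -gmulfF fq // gmulfF e mulgV.
have gM : monoid_morphism g.
  split=> [|x y]; first by rewrite -(@gmulf1 _ _ q) gE gmulf1.
  have [[x' <-] [y' <-]] := (q_surj x, q_surj y).
  by rewrite -gmulfM !gE gmulfM.
pose g' : UMagmaMorphism.type G H :=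
  HB.pack g (isUMagmaMorphism.Build G H g gM).
by exists g'.
Qed.

End Descent.

(** * Universal property and induction principle of free groups *)

Section FreeLift.
Variable E : Type.
Implicit Types (x y : free_group E) (e : E).

Definition free_gen e : free_group E := free_pi [:: (true, e)].

Lemma free_piM u v : free_pi (u ++ v) = free_pi u * free_pi v :> free_group E.
Proof.
by apply/free_piP/word_sym/word_equiv_cat; apply: free_repr_pi.
Qed.

Lemma free_piV e : free_pi [:: (false, e)] = (free_gen e)^-1 :> free_group E.
Proof.
apply/esym/mulg1_eq; rewrite -free_piM.
exact/free_piP/(word_cancel [::] true e [::]).
Qed.

(** The step is an equivalence because words also contain inverse letters: the converse implication,
    taken at [x * (free_gen e)^-1], appends an inverse letter. *)
Lemma free_ind (P : free_group E -> Prop) :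
  P 1 -> (forall x e, P x <-> P (x * free_gen e)) -> forall x, P x.
Proof.
move=> P1 PM x; rewrite -(free_reprK x).
elim/last_ind: (free_repr x) => [//|u [b e]]; rewrite -cats1 free_piM => Pu.
case: b; first by rewrite -PM.
by rewrite free_piV; apply: (PM _ e).2; rewrite mulgVK.
Qed.

Section Lift.
Variables (H : groupType) (f : E -> H).

Definition letter_val (l : bool * E) : H := if l.1 then f l.2 else (f l.2)^-1.
Definition word_val (u : word E) : H := foldr (fun l h => letter_val l * h) 1 u.

Lemma word_val_cat u v : word_val (u ++ v) = word_val u * word_val v.
Proof. by elim: u => [|l u IH] /=; rewrite ?mul1g // IH mulgA. Qed.

Lemma word_val_equiv u v : word_equiv u v -> word_val u = word_val v.
Proof.
elim=> {u v} // [u b e v|u v w _ -> _ ->] //.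
rewrite !word_val_cat /=; congr (_ * _).
by case: b; rewrite /letter_val /= ?mulKg ?mulVKg.
Qed.

Definition free_lift x : H := word_val (free_repr x).

Lemma free_lift_pi u : free_lift (free_pi u) = word_val u.
Proof. exact/word_val_equiv/free_repr_pi. Qed.

Lemma free_lift_morph : monoid_morphism free_lift.
Proof.
split=> [|x y]; first by rewrite free_lift_pi.
by rewrite -[in LHS](free_reprK x) -[in LHS](free_reprK y) -free_piM
           free_lift_pi word_val_cat.
Qed.

HB.instance Definition _ :=
  isUMagmaMorphism.Build (free_group E) H free_lift free_lift_morph.

Lemma free_lift_gen e : free_lift (free_gen e) = f e.
Proof. by rewrite free_lift_pi /= mulg1. Qed.

End Lift.

Lemma free_ext (H : groupType) (f g : UMagmaMorphism.type (free_group E) H) :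
  (forall e, f (free_gen e) = g (free_gen e)) -> forall x, f x = g x.
Proof.
move=> fg; apply: free_ind => [|x e]; first by rewrite !gmulf1.
by rewrite !gmulfM fg; split=> [->|/mulIg].
Qed.

End FreeLift.

Lemma triple_commg_lift (G H : groupType) (f : UMagmaMorphism.type G H) :
  (forall x y z : H, [~ [~ x, y], z] = 1) ->
  forall x, triple_commg x -> f x = 1.
Proof.
move=> nil2 x; elim=> {x} [x y z||x y _ IHx _ IHy|x _ IH|x y _ IH].
- by rewrite !gmulfR nil2.
- exact: gmulf1.
- by rewrite gmulfM IHx IHy mulg1.
- by rewrite gmulfV IH invg1.
- by rewrite gmulfJ IH conj1g.
Qed.

(** * Tensor equivalences *)

Lemma cmp_eqr (C : category) (w x y y' z : C) (g : hom y z) (f : hom x y)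
    (g' : hom y' z) (f' : hom x y') (e : hom w x) :
  g \oc f = g' \oc f' -> g \oc (f \oc e) = g' \oc (f' \oc e).
Proof. by move=> gf; rewrite !cmpA gf. Qed.

Section Groupoid.
Variable P : symmon.
Implicit Types x y z : P.

Definition minv x y (f : hom x y) : hom y x := projT1 (cid (grp_iso f)).

Lemma cmpVm x y (f : hom x y) : minv f \oc f = idm x.
Proof. by rewrite /minv; case: cid => g []. Qed.

Lemma cmpmV x y (f : hom x y) : f \oc minv f = idm y.
Proof. by rewrite /minv; case: cid => g []. Qed.

Lemma cmpKm x y z (f : hom y z) (g : hom x y) : minv f \oc (f \oc g) = g.
Proof. by rewrite cmpA cmpVm cmp1m. Qed.

Lemma cmpVKm x y z (f : hom z y) (g : hom x y) : f \oc (minv f \oc g) = g.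
Proof. by rewrite cmpA cmpmV cmp1m. Qed.

Lemma cmpIm x y z (f : hom y z) (g g' : hom x y) : f \oc g = f \oc g' -> g = g'.
Proof. by move=> e; rewrite -(cmpKm f g) e cmpKm. Qed.

Lemma cmpmI x y z (f : hom x y) (g g' : hom y z) : g \oc f = g' \oc f -> g = g'.
Proof. by move=> e; rewrite -(cmpm1 g) -(cmpmV f) cmpA e -cmpA cmpmV cmpm1. Qed.

End Groupoid.

Section TensorNatInverse.
Variables (P Q : picard) (F G : tensor_functor P Q) (t : tensor_nat F G).

Program Definition tensor_nat_inv : tensor_nat G F :=
  @TensorNat P Q G F (fun x => minv (t x)) _ _ _.
Next Obligation.
move=> x y f /=; apply: (cmpIm (f := t y)).
by rewrite cmpVKm cmpA tnat_nat -cmpA cmpmV cmpm1.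
Qed.
Next Obligation.
move=> x y /=; apply: (cmpIm (f := t (ten x y))).
rewrite cmpVKm cmpA tnat_mul -cmpA -tenmM !cmpmV tenm1 cmpm1 //.
Qed.
Next Obligation. by rewrite -(tnat_unit t) cmpKm. Qed.

Lemma tensor_nat_iso : @is_iso (tensor_hom P Q) F G t.
Proof.
exists tensor_nat_inv.
by split; apply: tensor_nat_eq => x /=; rewrite ?cmpVm ?cmpmV.
Qed.

End TensorNatInverse.

(** * Quasi-inverse of a fully faithful, essentially surjective tensor functor *)

Section QuasiInverse.
Variables (P Q : picard) (F : tensor_functor P Q).
Hypothesis F_full : forall x y (g : hom (F x) (F y)), exists f, fmap F f = g.
Hypothesis F_faithful : forall x y (f g : hom x y), fmap F f = fmap F g -> f = g.
Hypothesis F_surj : forall q : Q, exists x : P, exists f : hom (F x) q, True.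

Let lift x y (g : hom (F x) (F y)) : hom x y := projT1 (cid (F_full g)).

Let liftK x y (g : hom (F x) (F y)) : fmap F (lift g) = g.
Proof. exact: projT2 (cid (F_full g)). Qed.

Definition qinv_ob (q : Q) : P := projT1 (cid (F_surj q)).
Definition qinv_eps (q : Q) : hom (F (qinv_ob q)) q :=
  projT1 (cid (projT2 (cid (F_surj q)))).

(** This map and the next two are the only ones that make the chosen isomorphisms [qinv_eps] a
    tensor transformation from the composite of [qinv] and [F] to the identity. *)
Definition qinv_map q r (g : hom q r) : hom (qinv_ob q) (qinv_ob r) :=
  lift (minv (qinv_eps r) \oc (g \oc qinv_eps q)).
Definition qinv_mul q r :
    hom (ten (qinv_ob q) (qinv_ob r)) (qinv_ob (ten q r)) :=
  lift (minv (qinv_eps (ten q r)) \oc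
        (tenm (qinv_eps q) (qinv_eps r) \oc minv (tmul F _ _))).
Definition qinv_unit : hom (munit P) (qinv_ob (munit Q)) :=
  lift (minv (qinv_eps (munit Q)) \oc minv (tunit F)).

Lemma qinv_mapE q r (g : hom q r) :
  qinv_eps r \oc fmap F (qinv_map g) = g \oc qinv_eps q.
Proof. by rewrite liftK cmpVKm. Qed.

Lemma qinv_mulE q r :
  qinv_eps (ten q r) \oc (fmap F (qinv_mul q r) \oc tmul F _ _) =
  tenm (qinv_eps q) (qinv_eps r).
Proof. by rewrite liftK -!cmpA cmpVKm cmpVm cmpm1. Qed.

Lemma qinv_unitE :
  qinv_eps (munit Q) \oc (fmap F qinv_unit \oc tunit F) = idm (munit Q).
Proof. by rewrite liftK -cmpA cmpVKm cmpVm. Qed.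

(** Laws of [qinv] live in [P], but faithfulness lets them be checked in [Q]. The free factor [w] is
    chosen to be the structure morphisms of [F] that the axioms of [F] absorb. *)
Lemma qinv_inj x (y : Q) z (u v : hom x (qinv_ob y)) (w : hom z (F x)) :
  qinv_eps y \oc (fmap F u \oc w) = qinv_eps y \oc (fmap F v \oc w) -> u = v.
Proof. by move=> e; apply/F_faithful/(cmpmI (f := w))/(cmpIm e). Qed.

Program Definition qinv_functor : functor Q P :=
  @Functor Q P qinv_ob qinv_map _ _.
Next Obligation.
move=> q; apply: (qinv_inj (w := idm _)).
by rewrite !cmpm1 qinv_mapE fmap1 cmp1m cmpm1.
Qed.
Next Obligation.
move=> q r s g f; apply: (qinv_inj (w := idm _)).
by rewrite !cmpm1 fmapM qinv_mapE cmpA qinv_mapE -!cmpA qinv_mapE.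
Qed.

Program Definition qinv : tensor_functor Q P :=
  @TensorFunctor Q P qinv_functor qinv_mul qinv_unit _ _ _ _ _.
Next Obligation.
move=> x x' y y' f g /=; apply: (qinv_inj (w := tmul F _ _)).
rewrite !fmapM -!cmpA -tmul_nat.
rewrite (cmp_eqr _ (qinv_mapE _)) qinv_mulE -tenmM -!qinv_mapE tenmM.
by rewrite -qinv_mulE -!cmpA.
Qed.
Next Obligation.
move=> x y z /=.
apply: (qinv_inj (w := tmul F _ _ \oc tenm (tmul F _ _) (idm _))).
rewrite !fmapM -!cmpA.
rewrite (cmp_eqr _ (qinv_mapE _)).
rewrite (cmp_eqr _ (esym (tmul_nat F _ _))) -tenmM fmap1 cmp1m.
have := tmul_asc F (qinv_ob x) (qinv_ob y) (qinv_ob z).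
rewrite -!cmpA => ->.
rewrite (cmp_eqr _ (esym (tmul_nat F _ _))) fmap1 (cmpA (tenm _ _)) -tenmM cmp1m.
have mulE q r t (e : hom t _) : qinv_eps (ten q r) \oc
    (fmap F (qinv_mul q r) \oc (tmul F _ _ \oc e)) =
    tenm (qinv_eps q) (qinv_eps r) \oc e.
  by rewrite -qinv_mulE -!cmpA.
by rewrite !mulE (cmpA (tenm _ _)) -!tenmM !cmpm1 !qinv_mulE asc_nat.
Qed.
Next Obligation.
move=> x /=.
apply: (qinv_inj (w := tmul F _ _ \oc tenm (tunit F) (idm _))).
rewrite !fmapM -!cmpA (cmp_eqr _ (qinv_mapE _)).
rewrite (cmp_eqr _ (esym (tmul_nat F _ _))) -tenmM fmap1 cmp1m.
have := tmul_lunit F (qinv_ob x); rewrite -!cmpA => ->.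
rewrite (cmpA (fmap F _)) (cmpA (qinv_eps _)) qinv_mulE -tenmM cmpm1.
by rewrite qinv_unitE lunit_nat.
Qed.
Next Obligation.
move=> x /=.
apply: (qinv_inj (w := tmul F _ _ \oc tenm (idm _) (tunit F))).
rewrite !fmapM -!cmpA (cmp_eqr _ (qinv_mapE _)).
rewrite (cmp_eqr _ (esym (tmul_nat F _ _))) -tenmM fmap1 cmp1m.
have := tmul_runit F (qinv_ob x); rewrite -!cmpA => ->.
rewrite (cmpA (fmap F _)) (cmpA (qinv_eps _)) qinv_mulE -tenmM cmpm1.
by rewrite qinv_unitE runit_nat.
Qed.
Next Obligation.
move=> x y /=; apply: (qinv_inj (w := tmul F _ _)).
rewrite !fmapM -!cmpA (cmp_eqr _ (qinv_mapE _)) qinv_mulE tmul_braid.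
by rewrite (cmpA (fmap F _)) (cmpA (qinv_eps _)) qinv_mulE braid_nat.
Qed.

Program Definition qinv_counit :
    tensor_nat (tensor_functor_comp F qinv) (tensor_functor_id Q) :=
  @TensorNat Q Q (tensor_functor_comp F qinv) (tensor_functor_id Q)
    qinv_eps _ _ _.
Next Obligation. by move=> x y f /=; rewrite qinv_mapE. Qed.
Next Obligation. by move=> x y /=; rewrite cmp1m qinv_mulE. Qed.
Next Obligation. by rewrite /= qinv_unitE. Qed.

Let eta x : hom (qinv_ob (F x)) x := lift (qinv_eps (F x)).

Program Definition qinv_unit_nat :
    tensor_nat (tensor_functor_comp qinv F) (tensor_functor_id P) :=
  @TensorNat P P (tensor_functor_comp qinv F) (tensor_functor_id P) eta _ _ _.
Next Obligation.
by move=> x y f /=; apply: F_faithful; rewrite !fmapM !liftK !cmpVKm.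
Qed.
Next Obligation.
move=> x y /=; apply: F_faithful; apply: (cmpmI (f := tmul F _ _)).
rewrite cmp1m !fmapM !liftK -!cmpA !cmpVKm cmpVm cmpm1.
by rewrite -tmul_nat !liftK.
Qed.
Next Obligation.
apply: F_faithful; rewrite /= !fmapM fmap1 !liftK -!cmpA !cmpVKm.
by rewrite cmpmV.
Qed.

Lemma ff_surj_equivalent : @equivalent picard_twocat P Q.
Proof.
exists F, qinv; split.
- by exists qinv_unit_nat; apply: tensor_nat_iso.
- by exists qinv_counit; apply: tensor_nat_iso.
Qed.

End QuasiInverse.

(** * Morphisms *)

Section FullyFaithful.
Variables (C D : sqmod) (f g : sqmor C D).

Section Inverse.
Variable t : tensor_nat (gamma_mor f) (gamma_mor g).

Lemma tnat_val1 : gval (t (1 : sq0 C)) = 1.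
Proof. by have /(congr1 (@gval _ _ _)) := tnat_unit t; rewrite /= mulg1. Qed.

Program Definition htp_of_tnat : homotopy f g :=
  @Homotopy C D f g (fun x => gval (t x)) _ _ _.
Next Obligation.
move=> x y /=; have /(congr1 (@gval _ _ _)) := tnat_mul t x y.
by rewrite /= mulg1 mul1g.
Qed.
Next Obligation. by move=> x /=; rewrite [X in _ * X](gvalP (t x)) mulKg. Qed.
Next Obligation.
(* The value at [bd a] is read off naturality for the morphism from [bd a] to the unit, where the
   component at the unit has value 1. *)
move=> a /=; pose b : ghom (bd a) 1 := GHom (esym (mul1g (bd a))).
have /(congr1 (@gval _ _ _)) := tnat_nat t (b : @hom (gamma_pic C) _ _).
by rewrite /= tnat_val1 mul1g => ->; rewrite mulKg.
Qed.

End Inverse.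

Lemma gamma_htp_bij : bijective (@gamma_htp C D f g).
Proof.
exists htp_of_tnat => [s|t]; first exact: homotopy_eq.
by apply: tensor_nat_eq => x; apply: ghom_eq.
Qed.

End FullyFaithful.

(** * Strictification of a tensor functor out of a 0-free module *)

Section EssentiallySurjective.
Variables (C D : sqmod) (F : tensor_functor (gamma_pic C) (gamma_pic D)).
Local Notation Fo := (fob F : sq0 C -> sq0 D).
Implicit Types (x y z : sq0 C) (u v : sq1 C) (a b d : sq1 D).

Let fval x y (f : ghom x y) : sq1 D := gval (@fmap _ _ F x y f).
Let mval x y : sq1 D := gval (tmul F x y).
Let uval : sq1 D := gval (tunit F).

Lemma fval_geq x y (e : x = y) : fval (geq e) = 1.
Proof. by case: y / e; rewrite /fval (@fmap1 _ _ F x). Qed.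

Lemma fvalM x y z (g : ghom y z) (f : ghom x y) :
  fval (gcmp g f) = fval g * fval f.
Proof. by rewrite /fval (@fmapM _ _ F x y z g f). Qed.

Lemma fvalP x y (f : ghom x y) : Fo x = Fo y * bd (fval f).
Proof. exact: gvalP. Qed.

(** This replaces transports when two morphisms have equal, but not convertible, sources and
    targets. *)
Lemma fval_ext x x' y y' (f : ghom x y) (g : ghom x' y') :
  x = x' -> y = y' -> gval f = gval g -> fval f = fval g.
Proof. by move=> ex ey; subst x' y' => /ghom_eq ->. Qed.

Lemma mvalP x y : Fo x * Fo y = Fo (x * y) * bd (mval x y).
Proof. exact: gvalP. Qed.

(** The associators of both groupoids have value 1, so the associativity axiom of [F] becomes a
    2-cocycle identity twisted by the action. *)
Lemma mval_asc x y z :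
  mval (x * y) z * act (mval x y) (Fo z) = mval x (y * z) * mval y z.
Proof.
have : fval (geq (esym (mulgA x y z))) * mval (x * y) z *
         (act (mval x y) (Fo z) * 1) =
       mval x (y * z) * (act 1 (Fo (y * z)) * mval y z) * 1.
  exact: (congr1 (@gval _ _ _) (tmul_asc F x y z)).
by rewrite fval_geq mul1g !mulg1 act1 mul1g.
Qed.

Lemma mval_1l x : mval 1 x * act uval (Fo x) = 1.
Proof.
have : fval (geq (mul1g x)) * mval 1 x * (act uval (Fo x) * 1) = 1.
  exact: (congr1 (@gval _ _ _) (tmul_lunit F x)).
by rewrite fval_geq mul1g mulg1.
Qed.

Lemma mval_1r x : mval x 1 * uval = 1.
Proof.
have : fval (geq (mulg1 x)) * mval x 1 * (act 1 (Fo 1) * uval) = 1.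
  exact: (congr1 (@gval _ _ _) (tmul_runit F x)).
by rewrite fval_geq mul1g act1 mul1g.
Qed.

Lemma mval_nat x x' y y' (f : ghom x x') (g : ghom y y') :
  mval x' y' * (act (fval f) (Fo y') * fval g) = fval (gten f g) * mval x y.
Proof. exact: (congr1 (@gval _ _ _) (@tmul_nat _ _ F x x' y y' f g)). Qed.

Lemma mval_braid x y : fval (gsym x y) * mval x y = mval y x * brk (Fo y) (Fo x).
Proof. exact: (congr1 (@gval _ _ _) (tmul_braid F x y)). Qed.

(* The pair (x, d) stands for the object F x * bd d of the target together with
   the isomorphism d from it to F x.  The tensor structure of F makes these
   pairs a group, which is nilpotent of class 2 because F is symmetric. *)
Definition lifting : Type := (sq0 C * sq1 D)%type.
HB.instance Definition _ := Choice.on lifting.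

Implicit Types h k l : lifting.

Definition lmul h k : lifting :=
  (h.1 * k.1, mval h.1 k.1 * (act h.2 (Fo k.1) * k.2)).
Definition lone : lifting := (1, uval).
Definition linv h : lifting :=
  (h.1^-1, act ((mval h.1^-1 h.1)^-1 * uval * h.2^-1) (Fo h.1)^-1).

(** Acting by [Fo y * Fo z] is acting by [Fo (y * z)] and then conjugating by [mval y z]; what
    remains is the cocycle identity [mval_asc]. *)
Lemma lmulA : associative lmul.
Proof.
move=> [x d] [y e] [z f]; rewrite /lmul /= mulgA; congr (_, _).
rewrite (actM (mval x y)) (actM (act d (Fo y))) -act_mul mvalP act_mul act_bd.
move: (act (mval x y) _) (act d _) (act e _) (mval_asc x y z) => p q r asc.
by rewrite /conjg !mulgA asc -!mulgA mulVKg.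
Qed.

Lemma lmul1g : left_id lone lmul.
Proof. by move=> [x d]; rewrite /lmul /= mul1g mulgA mval_1l mul1g. Qed.

Lemma lmulVg : left_inverse lone linv lmul.
Proof.
move=> [x d]; rewrite /lmul /= mulVg -act_mul mulVg act_id.
by rewrite -!mulgA mulVg mulg1 mulVKg.
Qed.

Lemma lmulgV : right_inverse lone linv lmul.
Proof.
move=> h; rewrite -[LHS]lmul1g -{1}(lmulVg (linv h)) -lmulA.
by rewrite (lmulA _ h) lmulVg lmul1g lmulVg.
Qed.

Lemma lmulg1 : right_id lone lmul.
Proof. by move=> h; rewrite -(lmulVg h) lmulA lmulgV lmul1g. Qed.

HB.instance Definition _ := isGroup.Build lifting
  lmulA lmul1g lmulg1 lmulVg lmulgV.

Lemma lifting_mulE h k :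
  h * k = (h.1 * k.1, mval h.1 k.1 * (act h.2 (Fo k.1) * k.2)) :> lifting.
Proof. by []. Qed.

Definition lsrc h : sq0 C := h.1.
Definition ltgt h : sq0 D := Fo h.1 * bd h.2.

Lemma lsrc_morph : monoid_morphism lsrc.
Proof. by []. Qed.

Lemma Fo1 : Fo 1 = bd uval^-1.
Proof.
rewrite gmulfV; apply/esym/divg1_eq.
by rewrite -invgM -(gvalP (tunit F)) invg1.
Qed.

Lemma ltgt_morph : monoid_morphism ltgt.
Proof.
split=> [|[x d] [y e]]; first by rewrite /ltgt Fo1 -gmulfM mulVg gmulf1.
rewrite /ltgt lifting_mulE /= gmulfM [bd (_ * e)]gmulfM bd_act.
rewrite !mulgA -mvalP /conjg.
by rewrite mulgK.
Qed.

HB.instance Definition _ :=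
  isUMagmaMorphism.Build lifting (sq0 C) lsrc lsrc_morph.
HB.instance Definition _ :=
  isUMagmaMorphism.Build lifting (sq0 D) ltgt ltgt_morph.

Definition unit_hom u : ghom (bd u) 1 := GHom (esym (mul1g (bd u))).
Definition shift_hom x u : ghom (x * bd u) x := GHom erefl.

(** The lifting with source [bd u] and target [bd a] whose isomorphism is the composite of [a] from
    [bd a] to 1, the unit constraint from 1 to [F 1], and the inverse of the image under [F] of [u]
    from [bd u] to 1. *)
Definition iota u a : lifting := (bd u, (fval (unit_hom u))^-1 * (uval * a)).

Lemma iota_inj u : injective (iota u).
Proof. by move=> a b [] /mulgI /mulgI. Qed.

Lemma Fo_bd u : Fo (bd u) = bd (uval^-1 * fval (unit_hom u)).
Proof. by rewrite (fvalP (unit_hom u)) Fo1 -gmulfM. Qed.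

(** Naturality of [tmul] in the morphism from [bd u] to the unit removes the factor [mval]: only a
    composition with the inverse of [F] of a morphism of value [u] remains. *)
Lemma mul_iota h u a :
  h * iota u a = (h.1 * bd u, (fval (shift_hom h.1 u))^-1 * (h.2 * a)) :> lifting.
Proof.
case: h => x d; rewrite lifting_mulE /=; congr (_, _).
have mE : fval (shift_hom x u) * mval x (bd u) = uval^-1 * fval (unit_hom u).
  have := mval_nat (geq (erefl x)) (unit_hom u).
  rewrite fval_geq act1 mul1g => e.
  have <- : mval x 1 = uval^-1 by apply/divg1_eq; rewrite invgK mval_1r.
  rewrite e; congr (_ * _); apply: fval_ext; rewrite ?mulg1 //.
  by rewrite /= act1 mul1g.
rewrite -(mulKg (fval (shift_hom x u)) (mval x (bd u))) mE.
rewrite Fo_bd act_bd -!mulgA; congr (_ * _).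
rewrite /conjg !invgM !invgK.
by rewrite -!mulgA !mulVKg !mulKg.
Qed.

Lemma iotaM u v a b : iota u a * iota v b = iota (u * v) (a * b).
Proof.
rewrite mul_iota /iota /=; congr (_, _); first by rewrite gmulfM.
rewrite !mulgA -invgM -fvalM; congr (_^-1 * _ * _ * _).
by apply: fval_ext; rewrite ?gmulfM.
Qed.

(** After multiplication by [k * h], the identity combines the naturality of the symmetry of [D]
    ([brk_sym_nat]) with the compatibility of [F] with the symmetries ([mval_braid]). *)
Lemma lifting_commg h k :
  [~ h, k] = iota (brk (lsrc k) (lsrc h)) (brk (ltgt k) (ltgt h)).
Proof.
apply: (@mulgI _ (k * h)); rewrite -commgC mul_iota lifting_mulE.
case: h k => [x d] [y e] /=; congr (_, _); first by rewrite bd_brk commgC.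
rewrite /ltgt /= -(mulgA (mval y x)) -brk_sym_nat (mulgA (mval y x)).
rewrite -mval_braid -mulgA.
have -> : fval (shift_hom (y * x) (brk y x)) = fval (gsym x y).
  by apply: fval_ext; rewrite ?bd_brk -?commgC.
by rewrite -[in RHS]mulgA mulKg.
Qed.

Lemma lifting_nil2 h k l : [~ [~ h, k], l] = 1.
Proof.
have iota1 : iota 1 1 = 1.
  by have := lifting_commg 1 1; rewrite commg1 !gmulf1 !brk1l.
rewrite lifting_commg -[RHS]iota1; congr iota.
  by rewrite (@gmulfR _ _ lsrc) brk_commr.
by rewrite (@gmulfR _ _ ltgt) brk_commr.
Qed.

(** The lift to the free group always exists; it descends to [sq0 C] because the kernel of [q]
    consists of triple commutators, which are trivial in [lifting]. *)
Lemma lifting_section : free_nil2 (sq0 C) ->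
  exists s : UMagmaMorphism.type (sq0 C) lifting, forall x, lsrc (s x) = x.
Proof.
case=> E [q [q_surj q_ker]].
pose f e : lifting := (q (free_gen e), 1).
have fq w : q w = 1 -> free_lift f w = 1.
  by move/q_ker; apply: triple_commg_lift; apply: lifting_nil2.
have [s sE] := descent q_surj fq; exists s => x; have [w <-] := q_surj x.
rewrite sE.
apply: (free_ext (f := lsrc \o free_lift f)) => e /=.
by rewrite free_lift_gen.
Qed.

Section Strictification.
Variable s : UMagmaMorphism.type (sq0 C) lifting.
Hypothesis s_src : forall x, lsrc (s x) = x.

(** The value forced by [s_bd]. Multiplicativity and compatibility with the brackets then follow
    from those of [s] by injectivity of [iota]. *)
Definition strict1 u : sq1 D := uval^-1 * (fval (unit_hom u) * (s (bd u)).2).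

Lemma s_bd u : s (bd u) = iota u (strict1 u).
Proof.
rewrite /iota /strict1 mulVKg mulKg -[X in (X, _)](s_src (bd u)).
by case: (s (bd u)).
Qed.

Lemma strict1_morph : monoid_morphism strict1.
Proof.
have sM : {morph strict1 : u v / u * v}.
  by move=> u v; apply: (@iota_inj (u * v)); rewrite -iotaM -!s_bd -gmulfM -gmulfM.
by split=> //; apply: (@mulgI _ (strict1 1)); rewrite -sM !mulg1.
Qed.

HB.instance Definition _ := isUMagmaMorphism.Build _ _ strict1 strict1_morph.

Program Definition strict : sqmor C D := @SQMor C D (ltgt \o s) strict1 _ _.
Next Obligation.
by move=> u; rewrite /= s_bd /ltgt /= Fo_bd -gmulfM -mulgA mulVKg mulKg.
Qed.
Next Obligation.
move=> x y; apply: (@iota_inj (brk x y)); rewrite -s_bd bd_brk gmulfR.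
by rewrite lifting_commg !s_src.
Qed.

Lemma strict_nat_subproof x : mor0 strict x = Fo x * bd (s x).2.
Proof. by rewrite -{2}(s_src x). Qed.

Program Definition strict_nat : tensor_nat (gamma_mor strict) F :=
  @TensorNat (gamma_pic C) (gamma_pic D) (gamma_mor strict) F
    (fun x => GHom (strict_nat_subproof x)) _ _ _.
Next Obligation.
move=> x y f; apply: ghom_eq; change (
  (s y).2 * strict1 (gval f) = fval f * (s x).2).
have -> : s x = s y * iota (gval f) (strict1 (gval f)).
  by rewrite -s_bd -gmulfM -gvalP.
have ef : fval (shift_hom (s y).1 (gval f)) = fval f.
  have ey : (s y).1 = y := s_src y.
  by apply: fval_ext; rewrite ?ey -?gvalP.
by rewrite mul_iota /= ef mulVKg.
Qed.
Next Obligation.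
move=> x y; apply: ghom_eq => /=; rewrite mulg1 gmulfM lifting_mulE /=.
by rewrite -!/(lsrc _) !s_src.
Qed.
Next Obligation. by apply: ghom_eq; rewrite /= mulg1 gmulf1. Qed.

End Strictification.

End EssentiallySurjective.

Lemma gamma_mor_surj (C D : sqmod)
    (F : tensor_functor (gamma_pic C) (gamma_pic D)) :
  free_nil2 (sq0 C) ->
  exists f : sqmor C D, @isomorphic (tensor_hom _ _) (gamma_mor f) F.
Proof.
move=> /(lifting_section F) [s s_src].
by exists (strict s_src), (strict_nat s_src); apply: tensor_nat_iso.
Qed.

(** * Coherence over a free group *)

Inductive derived_commg (G : groupType) : G -> Prop :=
| dcommg_comm x y : derived_commg [~ x, y]
| dcommg_one : derived_commg 1
| dcommg_mul x y : derived_commg x -> derived_commg y -> derived_commg (x * y)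
| dcommg_inv x : derived_commg x -> derived_commg x^-1
| dcommg_conj x y : derived_commg x -> derived_commg (x ^ y).

Lemma derived_commg_lift (G H : groupType) (f : UMagmaMorphism.type G H) :
  (forall x y, f x * f y = f y * f x) -> forall x, derived_commg x -> f x = 1.
Proof.
move=> fC x; elim=> {x} [x y||x y _ IHx _ IHy|x _ IH|x y _ IH].
- by rewrite gmulfR; apply/eqP/commgP/fC.
- exact: gmulf1.
- by rewrite gmulfM IHx IHy mulg1.
- by rewrite gmulfV IH invg1.
- by rewrite gmulfJ IH conj1g.
Qed.

Lemma triple_derived (G : groupType) (x : G) : triple_commg x -> derived_commg x.
Proof.
elim=> {x} [x y z||x y _ ? _ ?|x _ ?|x y _ ?].
- exact: dcommg_comm.
- exact: dcommg_one.
- exact: dcommg_mul.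
- exact: dcommg_inv.
- exact: dcommg_conj.
Qed.

(* The semidirect product of the functions on G with G acting by translation:
   a homomorphism into it prescribes the increments r (x * g) - r x of a
   function r on G. *)
Section Increments.
Variables (G : groupType) (A : zmodType).

Definition increments : Type := ((G -> A) * G)%type.
HB.instance Definition _ := gen_eqMixin increments.
HB.instance Definition _ := gen_choiceMixin increments.
Implicit Types u v w : increments.

Definition imul u v : increments :=
  (fun x => u.1 x + v.1 (x * u.2)%g, u.2 * v.2)%R.
Definition ione : increments := (fun _ => 0%R, 1).
Definition iinv u : increments := (fun x => - u.1 (x * u.2^-1)%g, u.2^-1)%R.

Lemma imulA : associative imul.
Proof.
move=> u v w; congr (_, _); last exact: mulgA.
by apply/funext => x; rewrite /imul /= mulgA addrA.
Qed.

Lemma imul1g : left_id ione imul.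
Proof.
case=> u x; congr (_, _); last exact: mul1g.
by apply/funext => y; rewrite /= mulg1 add0r.
Qed.

Lemma imulg1 : right_id ione imul.
Proof.
case=> u x; congr (_, _); last exact: mulg1.
by apply/funext => y; rewrite /= addr0.
Qed.

Lemma imulVg : left_inverse ione iinv imul.
Proof.
case=> u x; congr (_, _); last exact: mulVg.
by apply/funext => y; rewrite /= addNr.
Qed.

Lemma imulgV : right_inverse ione iinv imul.
Proof.
case=> u x; congr (_, _); last exact: mulgV.
by apply/funext => y; rewrite /= mulgK addrN.
Qed.

HB.instance Definition _ := isGroup.Build increments
  imulA imul1g imulg1 imulVg imulgV.

Definition ipos u : G := u.2.
Lemma ipos_morph : monoid_morphism ipos. Proof. by []. Qed.
HB.instance Definition _ := isUMagmaMorphism.Build increments G ipos ipos_morph.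

End Increments.

(** The homomorphism sending a generator [e] to the pair of [beta e] and [free_gen e] has [r x] as
    the value at 1 of its first component; its second component is the identity of the free
    group. *)
Lemma free_increments (E : Type) (A : zmodType)
    (beta : E -> free_group E -> A) :
  exists r : free_group E -> A,
    r 1 = 0%R /\ forall x e, r (x * free_gen e) = (r x + beta e x)%R.
Proof.
pose W : groupType := increments (free_group E) A.
pose pos : UMagmaMorphism.type W (free_group E) := @ipos (free_group E) A.
pose f e : W := (beta e, free_gen e).
have f2 x : pos (free_lift f x) = x.
  apply: (free_ext (f := pos \o free_lift f) (g := idfun)) => e /=.
  by rewrite free_lift_gen.
exists (fun x => (free_lift f x).1 1); split=> [|x e]; first by rewrite gmulf1.
have fM : free_lift f (x * free_gen e) = free_lift f x * f e.
  by rewrite gmulfM /= free_lift_gen.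
rewrite fM /= mul1g. congr (_ + beta e _)%R; exact: f2.
Qed.

(** * Sorted form of an element of a free group *)

Section OrderedProducts.
Variable E : eqType.
Local Notation G := (free_group E).
Implicit Types (x y w : G) (e f g : E) (s : seq E).

Variable le : rel E.
Hypotheses (le_tr : transitive le) (le_anti : antisymmetric le).
Hypotheses (le_total : total le).

Definition lt e f := (e != f) && le e f.

Lemma lt_irr e : lt e e = false. Proof. by rewrite /lt eqxx. Qed.

Lemma lt_asym e f : lt e f -> lt f e = false.
Proof.
case/andP=> nef ef; apply/negP => /andP [_ fe].
by case/eqP: nef; apply: le_anti; rewrite ef.
Qed.

Lemma lt_tr e f g : lt e f -> lt f g -> lt e g.
Proof.
move=> /[dup] ltef /andP [nef ef] /[dup] ltfg /andP [nfg fg].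
rewrite /lt (le_tr ef fg) andbT; apply/eqP => eg; subst g.
by rewrite (lt_asym ltef) in ltfg.
Qed.

(* [gpart e x] is e raised to its exponent sum in x. *)
Definition gpart e : G -> G :=
  free_lift (fun f => if f == e then free_gen e else 1).
HB.instance Definition _ e := UMagmaMorphism.on (gpart e).

Lemma gpart_gen e f : gpart e (free_gen f) = if f == e then free_gen e else 1.
Proof. exact: free_lift_gen. Qed.

Lemma gpartC e x y : gpart e x * gpart e y = gpart e y * gpart e x.
Proof.
have xC z : gpart e z * free_gen e = free_gen e * gpart e z.
  elim/free_ind: z => [|z f]; first by rewrite gmulf1 mul1g mulg1.
  rewrite gmulfM /= gpart_gen; case: eqP => _; last by rewrite mulg1.
  by rewrite mulgA; split=> [->|/mulIg].
elim/free_ind: y => [|y f]; first by rewrite gmulf1 mul1g mulg1.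
rewrite gmulfM /= gpart_gen; case: eqP => _; last by rewrite mulg1.
rewrite mulgA -[X in _ <-> _ = X]mulgA -xC [X in _ <-> _ = X]mulgA.
by split=> [->|/mulIg].
Qed.

Lemma gpart_derived e w : derived_commg w -> gpart e w = 1.
Proof. exact/derived_commg_lift/gpartC. Qed.

Definition letters x : seq E := sort le (undup [seq l.2 | l <- free_repr x]).

Lemma gpart_letters e x : e \notin letters x -> gpart e x = 1.
Proof.
rewrite mem_sort mem_undup /gpart /free_lift.
elim: (free_repr x) => [|[b f] u IH] //=; rewrite inE negb_or => /andP [ne eu].
by rewrite IH // mulg1 /letter_val /= eq_sym (negPf ne) invg1 if_same.
Qed.

Definition part_prod s x : G := foldr (fun e y => gpart e x * y) 1 s.

Definition oprod (P : pred E) x : G := part_prod (filter P (letters x)) x.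

Lemma part_prod_filter s x :
  part_prod s x = part_prod [seq e <- s | gpart e x != 1] x.
Proof.
elim: s => //= e s IH; case: eqP => [->|_] /=; last by rewrite IH.
by rewrite mul1g.
Qed.

(** [letters x] depends on the word chosen to represent [x]. A letter of exponent sum zero
    contributes a trivial factor, so every sorted list without repetition that contains the other
    letters gives the same product. *)
Lemma oprodE (P : pred E) s x :
  sorted le s -> uniq s -> (forall e, gpart e x != 1 -> e \in s) ->
  oprod P x = part_prod (filter P s) x.
Proof.
move=> s_sort s_uniq s_cover; rewrite /oprod part_prod_filter.
rewrite [RHS]part_prod_filter -!filter_predI.
rewrite (eq_filter (a2 := predI P (fun e => gpart e x != 1))); last first.
  by move=> e; rewrite /= andbC.
rewrite [in RHS](eq_filter (a2 := predI P (fun e => gpart e x != 1))); last first.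
  by move=> e; rewrite /= andbC.
rewrite !filter_predI; congr (part_prod (filter P _) x).
have lt_sort : sorted le (letters x) by apply: sort_sorted.
apply: (sorted_eq le_tr le_anti); try exact: sorted_filter.
apply: uniq_perm; rewrite ?filter_uniq ?sort_uniq ?undup_uniq // => e.
rewrite !mem_filter; case: eqP => //= ne; rewrite s_cover; last exact/eqP.
by apply: contraT => /gpart_letters.
Qed.

Lemma part_prod_ext s x y :
  (forall e, e \in s -> gpart e x = gpart e y) -> part_prod s x = part_prod s y.
Proof.
elim: s => //= e s IH xy; rewrite xy ?inE ?eqxx // IH // => f fs.
by apply: xy; rewrite inE fs orbT.
Qed.

(** The new letter joins the factor of [f]; bringing it from there to the right end conjugates it by
    the product of the later factors. *)
Lemma part_prod_gen s x f : sorted le s -> uniq s ->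
  part_prod s (x * free_gen f) =
  if f \in s then part_prod s x * free_gen f ^ part_prod (filter (lt f) s) x
  else part_prod s x.
Proof.
have notin t : f \notin t -> part_prod t (x * free_gen f) = part_prod t x.
  move=> ft; apply: part_prod_ext => e et; rewrite gmulfM /= gpart_gen.
  by case: eqP => [fe|_]; [rewrite fe et in ft | rewrite mulg1].
case: ifPn => [fs|/notin //].
elim: s fs => //= e s IH fs s_path /andP [es s_uniq].
have [e_min s_sort] := (order_path_min le_tr s_path, path_sorted s_path).
rewrite gmulfM /= gpart_gen; case: (eqVneq f e) => [fe|fe].
  subst e; rewrite lt_irr notin // (all_filterP _) -?mulgA -?conjgC //.
  apply/allP => g gs; rewrite /lt (allP e_min) // andbT.
  by apply: contraNneq es => ->.
rewrite inE (negPf fe) /= in fs.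
rewrite mulg1 IH // mulgA [X in if X then _ else _](_ : _ = false) //.
by apply/lt_asym; rewrite /lt eq_sym fe (allP e_min).
Qed.

Definition cover3 x y f :=
  sort le (undup (f :: letters x ++ letters y)).

Lemma cover3P x y f (s := cover3 x y f) :
  [/\ sorted le s, uniq s, f \in s,
      forall e, gpart e x != 1 -> e \in s & forall e, gpart e y != 1 -> e \in s].
Proof.
split; rewrite ?sort_uniq ?undup_uniq ?mem_sort ?mem_undup ?mem_head //.
- exact: sort_sorted.
- move=> e; apply: contraR; rewrite mem_sort mem_undup inE mem_cat !negb_or.
  by case/and3P=> _ /gpart_letters /eqP.
- move=> e; apply: contraR; rewrite mem_sort mem_undup inE mem_cat !negb_or.
  by case/and3P=> _ _ /gpart_letters /eqP.
Qed.

Lemma oprod_gen (P : pred E) x f :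
  oprod P (x * free_gen f) =
  if P f then oprod P x * free_gen f ^ oprod (fun g => P g && lt f g) x
  else oprod P x.
Proof.
have [s_sort s_uniq fs sx sy] := cover3P x (x * free_gen f) f.
rewrite !(oprodE _ s_sort s_uniq) // part_prod_gen ?sorted_filter ?filter_uniq //.
rewrite mem_filter fs andbT -filter_predI.
case: (P f) => //; congr (_ * _ ^ part_prod _ x).
by apply: eq_filter => g; apply: andbC.
Qed.

Lemma oprod_derived (P : pred E) x w : derived_commg w -> oprod P (x * w) = oprod P x.
Proof.
move=> w'; rewrite /oprod.
have xwE e : gpart e (x * w) = gpart e x.
  by rewrite gmulfM /= (gpart_derived _ w') mulg1.
rewrite (part_prod_ext (y := x)) //.
symmetry; apply: oprodE; rewrite ?sort_uniq ?undup_uniq //.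
  exact: sort_sorted.
by move=> e; rewrite -xwE; apply: contraR => /gpart_letters ->.
Qed.

Lemma oprod1 (P : pred E) : oprod P 1 = 1.
Proof.
rewrite /oprod; elim: (filter P _) => //= e s ->.
by rewrite gmulf1 mulg1.
Qed.

Lemma oprod_ext (P Q : pred E) x : P =1 Q -> oprod P x = oprod Q x.
Proof. by move=> PQ; rewrite /oprod (eq_filter PQ). Qed.

Definition sorted_word x := oprod predT x.
Definition tail_word e x := oprod (lt e) x.

Lemma sorted_word_gen x e :
  sorted_word (x * free_gen e) = sorted_word x * free_gen e ^ tail_word e x.
Proof. exact: oprod_gen. Qed.

Lemma tail_word_lt e f x : lt e f -> tail_word f (x * free_gen e) = tail_word f x.
Proof. by move=> /lt_asym fe; rewrite /tail_word oprod_gen fe. Qed.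

Lemma tail_word_gt e f x : lt e f ->
  tail_word e (x * free_gen f) = tail_word e x * free_gen f ^ tail_word f x.
Proof.
move=> ef; rewrite /tail_word oprod_gen ef; congr (_ * _ ^ _).
apply: oprod_ext => g; apply/andP/idP => [[]//|fg]; split=> //.
exact: lt_tr fg.
Qed.

Lemma sorted_word_rest x e :
  (sorted_word (x * free_gen e))^-1 * (x * free_gen e) =
  [~ tail_word e x, free_gen e] * ((sorted_word x)^-1 * x) ^ free_gen e.
Proof.
rewrite sorted_word_gen /commg /conjg !invgM !invgK !mulgA.
by rewrite !mulgK.
Qed.

Lemma sorted_word_derived x : derived_commg ((sorted_word x)^-1 * x).
Proof.
elim/free_ind: x => [|x e].
  by rewrite /sorted_word oprod1 invg1 mul1g; apply: dcommg_one.
rewrite sorted_word_rest; split=> [/dcommg_conj|].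
  by move=> kD; apply: dcommg_mul (kD _); apply: dcommg_comm.
move=> kD.
have := dcommg_mul (dcommg_inv (dcommg_comm (tail_word e x) (free_gen e))) kD.
by rewrite mulKg => /(dcommg_conj (free_gen e)^-1); rewrite conjgK.
Qed.

End OrderedProducts.

(* gam is the braiding of a symmetric monoidal groupoid whose objects are the
   elements of the free group G.  Such a groupoid is coherent: the value
   r (x), the composite of the braidings that sort the word x, is additive on
   the derived subgroup of G. *)
Section Coherence.
Variables (E : eqType) (A : zmodType).
Local Notation G := (free_group E).
Variable gam : G -> G -> A.
Implicit Types (x y z k l : G) (e f : E).

Hypothesis gamN : forall x y, gam y x = (- gam x y)%R.
Hypothesis gamMl : forall x y z,
  gam (y * z) x = (gam y x + gam z x + gam z [~ x, y])%R.
Hypothesis gam0 : forall k l,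
  derived_commg k -> derived_commg l -> gam k l = 0%R.

Let D := @derived_commg G.

Lemma gamMr x y k : D k -> gam x (y * k) = (gam x y + gam x k)%R.
Proof.
move=> kD; rewrite (gamN (y * k)) gamMl (gam0 kD (dcommg_comm x y)).
by rewrite (gamN x y) (gamN x k); abel.
Qed.

Lemma gamVr x k : D k -> gam x k^-1 = (- gam x k)%R.
Proof.
move=> kD; apply: (@addrI _ (gam x k)).
rewrite -gamMr; last exact: dcommg_inv.
rewrite mulgV addrN; apply: (@addrI _ (gam x 1)).
by rewrite -gamMr ?mulg1 ?addr0 //; apply: dcommg_one.
Qed.

Lemma gamJr x y k : D k -> gam x (k ^ y) = (gam x k + gam x [~ k, y])%R.
Proof.
have cD : D [~ k, y] by apply: dcommg_comm.
by move=> kD; rewrite -(gamMr _ _ cD) commgEl mulVKg.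
Qed.

Lemma gamMl_derivedl x k l : D k -> D l -> gam (x * k) l = gam x l.
Proof.
move=> kD lD; rewrite gamMl (gam0 kD lD) (gam0 kD (dcommg_comm l x)).
abel.
Qed.

Variable le : rel E.
Hypotheses (le_tr : transitive le) (le_anti : antisymmetric le).
Hypotheses (le_total : total le).

Let sw := sorted_word le.
Let tw := tail_word le.
Let rest x : G := (sw x)^-1 * x.
Let restD x : D (rest x). Proof. exact: sorted_word_derived. Qed.
(** The cost of sorting [x * free_gen e] once [x] has been written as [sw x * rest x]: the new
    letter crosses [rest x], then the letters of [sw x] greater than [e]. *)
Let beta e x := (gam (free_gen e) (rest x) + gam (free_gen e) (tw e x))%R.

Variable r : G -> A.
Hypothesis r1 : r 1 = 0%R.
Hypothesis r_gen : forall x e, r (x * free_gen e) = (r x + beta e x)%R.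

(** Induction on [x]. As [k * x = x * k ^ x], the factor [k] multiplies [rest x] by [k ^ x] and
    changes no tail; the additional increment is the one that [gamMl] gives to [gam x k]. *)
Lemma r_derived_l k x : D k -> r (k * x) = (r k + r x + gam x k)%R.
Proof.
move=> kD; have kxE y : k * y = y * k ^ y by rewrite -conjgC.
elim/free_ind: x => [|x e].
  have gam1 : gam 1 k = 0%R by apply: gam0 => //; apply: dcommg_one.
  by rewrite mulg1 r1 gam1; abel.
have kxD : D (k ^ x) by apply: dcommg_conj.
have restE : rest (k * x) = rest x * k ^ x.
  by rewrite /rest kxE /sw /sorted_word oprod_derived // mulgA.
have tailE : tw e (k * x) = tw e x.
  by rewrite kxE /tw /tail_word oprod_derived.
rewrite mulgA !r_gen /beta restE tailE gamMr // gamJr // gamMl.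
set p := gam (free_gen e) (rest x); set q := gam (free_gen e) (tw e x).
set a := gam (free_gen e) k; set b := gam (free_gen e) [~ k, x].
have -> : (r (k * x) + (p + (a + b) + q) = r (k * x) + (p + a + b + q))%R.
  by abel.
have -> : (r k + (r x + (p + q)) + (gam x k + a + b) =
           r k + r x + gam x k + (p + a + b + q))%R by abel.
by split=> [->|/addIr].
Qed.

(** If [f] is appended first, the larger letter [f] belongs to the tail that [e] crosses, whence the
    term [gam e f]. The other contributions agree: [k_swap] compares the crossings of [rest x] in
    both orders, [tail_swap] accounts for the conjugation of the letter [f] inside the tail. *)
Lemma r_swap x e f : lt le e f ->
  r (x * free_gen e * free_gen f) =
  (r (x * free_gen f * free_gen e) - gam (free_gen e) (free_gen f))%R.
Proof.
move=> ef; rewrite !r_gen /beta.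
rewrite /tw tail_word_lt // tail_word_gt // /rest !sorted_word_rest //.
rewrite -/sw -/(rest x) -/tw.
set q := tw e x; set t := tw f x; set ge := free_gen e; set gf := free_gen f.
have kD := restD x; set k : G := rest x in kD *.
have tfD : D [~ t, gf] by apply: dcommg_comm.
have qeD : D [~ q, ge] by apply: dcommg_comm.
have keD : D (k ^ ge) by apply: dcommg_conj.
have kfD : D (k ^ gf) by apply: dcommg_conj.
rewrite (gamMr _ _ keD) (gamMr _ _ kfD).
have k_swap : (gam ge k + gam gf (k ^ ge) = gam gf k + gam ge (k ^ gf))%R.
  have e1 : gam (ge * gf) k = (gam ge k + gam gf (k ^ ge))%R.
    by rewrite gamMl gamJr //; abel.
  have e2 : gam (gf * ge) k = (gam gf k + gam ge (k ^ gf))%R.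
    by rewrite gamMl gamJr //; abel.
  by rewrite -e1 -e2 (commgC ge gf) (gamMl_derivedl _ (dcommg_comm _ _) kD).
have tail_swap : (gam ge (q * gf ^ t) =
    gam ge q + gam ge gf - gam ge [~ t, gf] + gam gf [~ q, ge])%R.
  have gftE : gf ^ t = gf * [~ gf, t] by rewrite commgEl mulVKg.
  have ftD : D [~ gf, t] by apply: dcommg_comm.
  have eqD : D [~ ge, q] by apply: dcommg_comm.
  have e1 : gam ge (gf ^ t) = (gam ge gf - gam ge [~ t, gf])%R.
    by rewrite gftE gamMr // -invgR gamVr.
  have e2 : gam (gf ^ t) [~ ge, q] = (- gam gf [~ q, ge])%R.
    by rewrite gftE gamMl_derivedl // -invgR gamVr.
  rewrite (gamN (q * _)) gamMl (gamN ge q) (gamN ge (gf ^ t)) e1 e2.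
  abel.
rewrite !(tail_swap, gamMr _ _ qeD).
have -> : gam gf (k ^ ge) = (gam gf k + gam ge (k ^ gf) - gam ge k)%R.
  by rewrite -k_swap; abel.
abel.
Qed.

(** These elements form a normal subgroup. It contains the commutators of generators by [r_swap],
    hence it is the whole derived subgroup. *)
Let additive l := D l /\ forall x, r (x * l) = (r x + r l)%R.

Lemma additiveM l m : additive l -> additive m -> additive (l * m).
Proof.
move=> [lD lE] [mD mE]; split=> [|x]; first exact: dcommg_mul.
by rewrite mulgA !mE lE addrA.
Qed.

Lemma additiveV l : additive l -> additive l^-1.
Proof.
move=> [lD lE]; split=> [|x]; first exact: dcommg_inv.
have rV : r l^-1 = (- r l)%R.
  by apply: (@addIr _ (r l)); rewrite -lE mulVg r1 addNr.
by apply: (@addIr _ (r l)); rewrite -lE mulgVK rV; abel.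
Qed.

(** Put [z = x * y^-1] and carry [l] to the far left: [x * l ^ y = l' * x] and [z * l = l' * z].
    Applying [r_derived_l] to both products and eliminating [r l'] gives the formula. *)
Lemma r_derivedJ l y : additive l ->
  forall x, r (x * l ^ y) = (r x + (r l + gam y l))%R.
Proof.
move=> [lD lE] x; pose z := x * y^-1; pose l' := l ^ z^-1.
have l'D : D l' by apply: dcommg_conj.
have xE : x * l ^ y = l' * (z * y).
  rewrite /l' /z /conjg !invgM !invgK !mulgA.
  by rewrite (mulgVK x) (mulgVK y).
have zl : z * l = l' * z.
  by rewrite /l' /conjg invgK -!mulgA mulVg mulg1.
have := lE z; rewrite zl (r_derived_l z l'D) => rl.
rewrite xE (r_derived_l _ l'D) gamMl.
have -> : gam y l = (gam y l' + gam y [~ l', z])%R.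
  by rewrite -gamJr // /l' conjgKV.
have -> : x = z * y by rewrite /z mulgVK.
have -> : r l = (r l' + r z + gam z l' - r z)%R by rewrite rl; abel.
abel.
Qed.

Lemma additiveJ l y : additive l -> additive (l ^ y).
Proof.
move=> lS; have lyE := r_derivedJ y lS; split; first exact: dcommg_conj lS.1.
by move=> x; rewrite lyE; congr (_ + _)%R; rewrite -[l ^ y]mul1g lyE r1 add0r.
Qed.

Lemma additive_swap (a b : G) (c : A) :
  (forall x, r (x * a * b) = (r (x * b * a) + c)%R) -> additive [~ a, b].
Proof.
move=> rab; split=> [|x]; first exact: dcommg_comm.
have rE y : r (y * [~ a, b]) = (r y + c)%R.
  (* Multiplying by [[~ a, b]] replaces a final [b * a] by [a * b]. *)
  have -> : y * [~ a, b] = y / (b * a) * a * b.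
    by rewrite /commg /conjg invgM !mulgA.
  by rewrite rab -(mulgA _ b) mulgVK.
by rewrite rE -[X in (_ + r X)%R]mul1g rE r1 add0r.
Qed.

Lemma additive_gen e f : additive [~ free_gen e, free_gen f].
Proof.
case: (eqVneq e f) => [->|nef].
  by rewrite commgg; split=> [|x]; [apply: dcommg_one | rewrite r1 mulg1 addr0].
have /orP [ef|fe] := le_total e f.
  by apply: additive_swap => x; apply: r_swap; rewrite /lt nef.
rewrite -invgR; apply: additiveV; apply: additive_swap => x.
by apply: r_swap; rewrite /lt eq_sym nef.
Qed.

Lemma additive_commg x y : additive [~ x, y].
Proof.
have commM (a b c : G) : [~ a * b, c] = [~ a, c] ^ b * [~ b, c].
  by rewrite /commg /conjg !invgM !mulgA !mulgK.
have add1 : additive 1.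
  by split=> [|z]; [apply: dcommg_one | rewrite r1 mulg1 addr0].
have gen_r e : additive [~ x, free_gen e].
  elim/free_ind: x => [|x f]; first by rewrite comm1g.
  rewrite commM; split=> [/(@additiveJ _ (free_gen f)) xe|xe].
    by apply: additiveM xe _; apply: additive_gen.
  have := additiveM xe (additiveV (additive_gen f e)); rewrite mulgK.
  by move/(@additiveJ _ (free_gen f)^-1); rewrite conjgK.
elim/free_ind: y => [|y e]; first by rewrite commg1.
have commMr (a b c : G) : [~ a, b * c] = [~ a, c] * [~ a, b] ^ c.
  by rewrite -(invgR (b * c)) commM invgM -conjVg !invgR.
rewrite commMr; split=> [/(@additiveJ _ (free_gen e))|].
  exact: additiveM (gen_r e).
move/(additiveM (additiveV (gen_r e))); rewrite mulKg.
by move/(@additiveJ _ (free_gen e)^-1); rewrite conjgK.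
Qed.

Lemma additive_derived l : D l -> additive l.
Proof.
elim=> {l} [x y||x y _ ? _ ?|x _ ?|x y _ ?].
- exact: additive_commg.
- by split=> [|z]; [apply: dcommg_one | rewrite r1 mulg1 addr0].
- exact: additiveM.
- exact: additiveV.
- exact: additiveJ.
Qed.

End Coherence.

Lemma total_orderP (E : eqType) :
  exists le : rel E, [/\ transitive le, antisymmetric le & total le].
Proof.
have [le le_wo] := well_ordering_principle E.
have le_wo' : wo_chain le predT by move=> C _; apply: le_wo.
have le_total : total le by move=> x y; apply: wo_chainW le_wo' _ _ _ _.
have le_anti : antisymmetric le.
  by move=> x y; apply: wo_chain_antisymmetric le_wo' _ _ _ _.
exists le; split=> // y x z xy yz.
(* Transitivity is read off the minimum of the three elements. *)
have ne : nonempty (mem [:: x; y; z]) by exists x; apply: mem_head.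
have [m [[m_in m_min] _]] := le_wo _ ne.
have [mx my mz] : [/\ le m x, le m y & le m z].
  by split; apply: m_min; rewrite !inE eqxx ?orbT.
move: m_in; rewrite !inE => /or3P [] /eqP em; subst m => //.
- by rewrite (le_anti x y) // xy.
- by rewrite -(le_anti y z) // yz.
Qed.

Lemma coherence (E : Type) (A : zmodType)
    (gam : free_group E -> free_group E -> A) :
  (forall x y, gam y x = - gam x y)%R ->
  (forall x y z, gam (y * z) x = gam y x + gam z x + gam z [~ x, y])%R ->
  (forall k l, derived_commg k -> derived_commg l -> gam k l = 0)%R ->
  exists psi : free_group E -> A,
    (forall k l, derived_commg k -> derived_commg l ->
       psi (k * l) = psi k + psi l)%R /\
    (forall k x, derived_commg k -> psi (k ^ x) = psi k + gam x k)%R.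
Proof.
move=> gamN gamMl gam0.
(* [{classic E}] gives the arbitrary type [E] the equality test needed for sorting. *)
have [le [le_tr le_anti le_total]] := total_orderP {classic E}.
pose beta (e : {classic E}) (x : free_group {classic E}) :=
  (gam (free_gen e) ((sorted_word le x)^-1 * x) +
   gam (free_gen e) (tail_word le e x))%R.
have [r [r1 r_gen]] := free_increments beta.
have additive k (kD : derived_commg k) := @additive_derived {classic E} A gam
  gamN gamMl gam0 le le_tr le_anti le_total r r1 r_gen k kD.
exists r; split=> [k l _ lD|k x kD]; first exact: (additive l lD).2.
have := @r_derivedJ {classic E} A gam gamN gamMl gam0 le le_tr le_anti
  le_total r r1 r_gen k x (additive k kD) 1.
by rewrite mul1g r1 add0r.
Qed.

(** * The cocycle of a Picard groupoid *)

(** Derives [x = y] from a known identity [a = b] when [x - y] and [a - b] are formally equal;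
    [abel_using] tries both orientations. *)
Lemma abel_from (V : zmodType) (a b x y : V) :
  a = b -> (x + b = y + a)%R -> x = y.
Proof. by move=> -> /addIr. Qed.

Ltac abel_using e :=
  first [apply: (abel_from e); abel | apply: (abel_from (esym e)); abel].

(* An invariant nrm of the morphisms that is additive for the composition, and
   additive up to a coboundary d for the tensor product, turns the constraints
   of P into a symmetric 3-cocycle (h, c). *)
Section Cochains.
Variables (P : symmon) (A : zmodType).
Variables (nrm : forall x y : P, hom x y -> A) (d : P -> P -> A).
Local Notation "'I" := (munit P).
Implicit Types w x y z : P.

Hypothesis nrmM : forall x y z (g : hom y z) (f : hom x y),
  nrm (g \oc f) = (nrm g + nrm f)%R.
Hypothesis nrm_ten : forall x x' y y' (f : hom x x') (g : hom y y'),
  nrm (tenm f g) = (nrm f + nrm g + d x y - d x' y')%R.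

Lemma nrm1 x : nrm (idm x) = 0%R.
Proof. by apply: (@addrI _ (nrm (idm x))); rewrite -nrmM cmp1m addr0. Qed.

Definition assoc_cocycle x y z :=
  (nrm (asc x y z) + d x (ten y z) + d y z - d (ten x y) z - d x y)%R.
Definition braid_cocycle x y := (nrm (braid x y) + d y x - d x y)%R.
Definition lunit_cochain x := (nrm (lunit x) - d 'I x)%R.
Definition runit_cochain x := (nrm (runit x) - d x 'I)%R.

Local Notation h := assoc_cocycle.
Local Notation c := braid_cocycle.

Lemma assoc_cocycle_nat x x' y y' z z'
    (f : hom x x') (g : hom y y') (k : hom z z') :
  h x y z = h x' y' z'.
Proof.
have := congr1 (@nrm _ _) (asc_nat f g k); rewrite !nrmM !nrm_ten => e.
by rewrite /h; abel_using e.
Qed.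

Lemma braid_cocycle_nat x x' y y' (f : hom x x') (g : hom y y') : c x y = c x' y'.
Proof.
have := congr1 (@nrm _ _) (braid_nat f g); rewrite !nrmM !nrm_ten => e.
by rewrite /c; abel_using e.
Qed.

Lemma lunit_cochain_nat x y (f : hom x y) : lunit_cochain x = lunit_cochain y.
Proof.
have := congr1 (@nrm _ _) (lunit_nat f); rewrite !nrmM !nrm_ten nrm1 => e.
by rewrite /lunit_cochain; abel_using e.
Qed.

Lemma runit_cochain_nat x y (f : hom x y) : runit_cochain x = runit_cochain y.
Proof.
have := congr1 (@nrm _ _) (runit_nat f); rewrite !nrmM !nrm_ten nrm1 => e.
by rewrite /runit_cochain; abel_using e.
Qed.

Lemma assoc_cocycleP w x y z :
  (h x y z + h w (ten x y) z + h w x y = h (ten w x) y z + h w x (ten y z))%R.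
Proof.
have := congr1 (@nrm _ _) (pentagon w x y z); rewrite !nrmM !nrm_ten !nrm1 => e.
by rewrite /h; abel_using e.
Qed.

Lemma assoc_cocycle_unit x y : h x 'I y = (runit_cochain x - lunit_cochain y)%R.
Proof.
have := congr1 (@nrm _ _) (triangle x y); rewrite !nrmM !nrm_ten !nrm1 => e.
by rewrite /h /runit_cochain /lunit_cochain; abel_using e.
Qed.

(** With all four arguments the unit, naturality turns the cocycle identity into three copies of
    [h 'I 'I 'I] on the left against two on the right. So this value is zero, and by the triangle it
    is the difference of the two unit cochains. *)
Lemma unit_cochain_munit : lunit_cochain 'I = runit_cochain 'I.
Proof.
have := assoc_cocycleP 'I 'I 'I 'I.
rewrite (assoc_cocycle_nat (idm 'I) (lunit 'I) (idm 'I)).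
rewrite (assoc_cocycle_nat (lunit 'I) (idm 'I) (idm 'I)).
rewrite (assoc_cocycle_nat (idm 'I) (idm 'I) (lunit 'I)).
rewrite !assoc_cocycle_unit => e.
by symmetry; abel_using e.
Qed.

Lemma braid_cocycle_hexagon x y z :
  (h y z x + c x (ten y z) + h x y z = c x z + h y x z + c x y)%R.
Proof.
have := congr1 (@nrm _ _) (hexagon x y z); rewrite !nrmM !nrm_ten !nrm1 => e.
by rewrite /h /c; abel_using e.
Qed.

Lemma braid_cocycleN x y : c y x = (- c x y)%R.
Proof.
have := congr1 (@nrm _ _) (braidK x y); rewrite !nrmM !nrm1 => e.
by rewrite /c; abel_using e.
Qed.

End Cochains.

Section EquivalenceFullyFaithful.
Variables C D : category.

Lemma nat_isomorphic_faithful (F : functor C C) :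
  nat_isomorphic F (functor_id C) ->
  forall x y (f g : hom x y), fmap F f = fmap F g -> f = g.
Proof.
case=> t [t_nat t_iso] x y f g e; have [s [_ ts]] := t_iso x.
by have := t_nat _ _ f; rewrite e t_nat /= => /(congr1 (fun k => k \oc s));
  rewrite -!cmpA ts !cmpm1.
Qed.

End EquivalenceFullyFaithful.

Lemma equivalence_ff (C D : category) (F : functor C D) : is_equivalence F ->
  (forall x y (f g : hom x y), fmap F f = fmap F g -> f = g) /\
  (forall x y (g : hom (F x) (F y)), exists f, fmap F f = g).
Proof.
case=> G [GF FG].
have F_inj x y (f g : hom x y) : fmap F f = fmap F g -> f = g.
  by move=> e; apply: (nat_isomorphic_faithful GF); rewrite /= e.
have G_inj x y (f g : hom x y) : fmap G f = fmap G g -> f = g.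
  by move=> e; apply: (nat_isomorphic_faithful FG); rewrite /= e.
split=> // x y g; have [t [t_nat t_iso]] := GF.
have [[s [st ts]] [s' [s't ts']]] := (t_iso x, t_iso y).
(* The only candidate, by naturality of [t]; that [F] sends it to [g] is tested after the faithful
   functor [G]. *)
exists (t y \oc (fmap G g \oc s)); apply: G_inj.
have /= := t_nat _ _ (t y \oc (fmap G g \oc s)).
rewrite -!cmpA st cmpm1 => /(congr1 (fun k => s' \oc k)).
by rewrite !cmpA s't !cmp1m.
Qed.

(** * Measuring morphisms by automorphisms of the unit *)

Section Scalars.
Variable P : picard.
Local Notation "'I" := (munit P).
Implicit Types x y z : P.

Definition scalar : Type := @hom P 'I 'I.
HB.instance Definition _ := gen_eqMixin scalar.
HB.instance Definition _ := gen_choiceMixin scalar.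
Implicit Types a b : scalar.

(* The Eckmann-Hilton argument *)
Lemma scalarC a c : a \oc c = c \oc a.
Proof.
pose j := runit 'I \oc minv (lunit 'I); pose b := minv j \oc (c \oc j).
have jL : j \oc lunit 'I = runit 'I by rewrite /j -cmpA cmpVm cmpm1.
have Rb : runit 'I \oc tenm (idm 'I) b = c \oc runit 'I.
  have jb : j \oc b = c \oc j by rewrite /b cmpVKm.
  by rewrite -jL -(cmpA j) lunit_nat (cmpA j) jb -(cmpA c).
apply: (cmpmI (f := runit 'I)); rewrite -!cmpA -Rb -(runit_nat a).
rewrite cmpA -(runit_nat a) -cmpA -tenmM cmp1m cmpm1 cmpA -Rb -cmpA -tenmM.
by rewrite cmp1m cmpm1.
Qed.

Lemma scalarA : associative (fun a b : scalar => a \oc b : scalar).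
Proof. by move=> a b c; apply: cmpA. Qed.

Lemma scalar_idl : left_id (idm 'I : scalar) (fun a b : scalar => a \oc b : scalar).
Proof. by move=> a; apply: cmp1m. Qed.

Lemma scalar_inv : left_inverse (idm 'I : scalar) (fun a : scalar => minv a : scalar)
  (fun a b : scalar => a \oc b : scalar).
Proof. by move=> a; apply: cmpVm. Qed.

HB.instance Definition _ := isZmodule.Build scalar
  scalarA scalarC scalar_idl scalar_inv.

Definition scal x a : hom x x := lunit x \oc (tenm a (idm x) \oc minv (lunit x)).

Lemma scalD x a b : scal x (a + b)%R = scal x a \oc scal x b.
Proof.
by rewrite /scal -!cmpA cmpKm (cmpA (tenm a _)) -tenmM cmp1m.
Qed.

Lemma scal0 x : scal x 0%R = idm x.
Proof. by rewrite /scal tenm1 cmp1m cmpmV. Qed.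

Lemma scal_nat x y (f : hom x y) a : f \oc scal x a = scal y a \oc f.
Proof.
have e : tenm (idm 'I) f \oc minv (lunit x) = minv (lunit y) \oc f.
  apply: (cmpIm (f := lunit y)).
  by rewrite cmpVKm cmpA lunit_nat -cmpA cmpmV cmpm1.
rewrite /scal -!cmpA -e (cmpA (tenm a _)) -tenmM cmpm1 cmp1m.
rewrite cmpA -lunit_nat -cmpA; congr (_ \oc _).
by rewrite cmpA -tenmM cmpm1 cmp1m.
Qed.

Lemma tenm_scalar_braid x a :
  tenm a (idm x) = minv (braid 'I x) \oc (tenm (idm x) a \oc braid 'I x).
Proof. by rewrite -braid_nat cmpKm. Qed.

(** Up to conjugation by the unit constraint and the braiding, [scal x] is the action of tensoring
    with [x] on the automorphisms of the unit. Tensoring is fully faithful, which gives this lemma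
    and [scal_surj]. *)
Lemma scal_inj x : injective (scal x).
Proof.
move=> a b /cmpIm /cmpmI; rewrite !tenm_scalar_braid => /cmpIm /cmpmI.
exact: (equivalence_ff (pic_ten x)).1.
Qed.

Lemma scal_surj x (g : hom x x) : exists a, scal x a = g.
Proof.
have [a aE] := (equivalence_ff (pic_ten x)).2 'I 'I
  (braid 'I x \oc (minv (lunit x) \oc (g \oc lunit x)) \oc minv (braid 'I x)).
exists a; rewrite /scal tenm_scalar_braid [tenm _ a]aE.
by rewrite -!cmpA !cmpKm cmpVKm cmpmV cmpm1.
Qed.

Lemma autC x (f g : hom x x) : f \oc g = g \oc f.
Proof. by have [a <-] := scal_surj f; rewrite scal_nat. Qed.

(** No coherence between [J] and the left unit constraint is needed: since automorphisms commute,
    two isomorphisms with the same source and target conjugate an automorphism to the same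
    result. *)
Lemma scal_tenl x y a : tenm (scal x a) (idm y) = scal (ten x y) a.
Proof.
pose J := tenm (lunit x) (idm y) \oc minv (asc 'I x y).
have JE : tenm (scal x a) (idm y) \oc J = J \oc tenm a (idm (ten x y)).
  apply: (cmpmI (f := asc 'I x y)).
  rewrite -!cmpA cmpVm cmpm1 -tenm1 -asc_nat cmpKm -!tenmM.
  by rewrite /scal -!cmpA cmpVm !cmpm1.
have LE : scal (ten x y) a \oc lunit _ = lunit _ \oc tenm a (idm (ten x y)).
  by rewrite /scal -!cmpA cmpVm cmpm1.
apply: (cmpmI (f := J)); rewrite JE -(cmpVKm (lunit (ten x y)) J).
by rewrite -cmpA autC !cmpA LE.
Qed.

Lemma scal_tenr x y a : tenm (idm x) (scal y a) = scal (ten x y) a.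
Proof.
by apply: (cmpIm (f := braid x y)); rewrite braid_nat scal_nat scal_tenl.
Qed.

Definition iso_rel : rel {classic (obj P)} :=
  fun x y => `[< exists f : @hom P x y, True >].

Lemma iso_rel_refl : reflexive iso_rel.
Proof. by move=> x; apply/asboolP; exists (idm (x : P)). Qed.

Lemma iso_rel_sym : symmetric iso_rel.
Proof.
by move=> x y; apply/asboolP/asboolP => -[f _]; exists (minv f).
Qed.

Lemma iso_rel_trans : transitive iso_rel.
Proof.
move=> y x z /asboolP [f _] /asboolP [g _]; apply/asboolP.
by exists (g \oc f).
Qed.

Canonical iso_equivRel :=
  EquivRel iso_rel iso_rel_refl iso_rel_sym iso_rel_trans.

Definition iso_class := {eq_quot iso_rel}.
HB.instance Definition _ := Choice.on iso_class.

Definition cls (x : P) : iso_class := \pi_{eq_quot iso_rel} (x : {classic (obj P)}).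
Definition rep (p : iso_class) : P := repr (p : {eq_quot iso_rel}).
Implicit Types p q r : iso_class.

Lemma repK p : cls (rep p) = p.
Proof. exact: reprK. Qed.

Lemma clsP x y : cls x = cls y <-> exists f : hom x y, True.
Proof. by split=> [/eqmodP/asboolP|xy] //; apply/eqmodP/asboolP. Qed.

Lemma cls_hom x y (f : hom x y) : cls x = cls y.
Proof. by apply/clsP; exists f. Qed.

Lemma to_rep_subproof x : exists f : hom x (rep (cls x)), True.
Proof. by apply/clsP; rewrite repK. Qed.

Definition to_rep x : hom x (rep (cls x)) := projT1 (cid (to_rep_subproof x)).

Definition rep_cast p q (e : p = q) : hom (rep p) (rep q) :=
  let: erefl := e in idm (rep p).

(** One reference isomorphism between any two isomorphic objects, through their common
    representative. By [kappa_refl] and [kappa_cmp] these are closed under composition, so that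
    measuring a morphism against them is additive. *)
Definition kappa x y (e : cls x = cls y) : hom x y :=
  minv (to_rep y) \oc (rep_cast e \oc to_rep x).

Lemma kappa_refl x e : kappa e = idm x.
Proof. by rewrite (Prop_irrelevance e erefl) /kappa cmp1m cmpVm. Qed.

Lemma kappa_cmp x y z (e : cls x = cls y) (e' : cls y = cls z) :
  kappa e' \oc kappa e = kappa (etrans e e').
Proof.
rewrite /kappa -!cmpA cmpVKm (cmpA (rep_cast e')).
by congr (_ \oc (_ \oc _)); case: _ / e'; rewrite /= cmp1m.
Qed.

Lemma kappa_irr x y (e e' : cls x = cls y) : kappa e = kappa e'.
Proof. by rewrite (Prop_irrelevance e e'). Qed.

Lemma nrm_subproof x y (f : hom x y) :
  exists a, scal y a \oc kappa (cls_hom f) = f.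
Proof.
have [a aE] := scal_surj (f \oc minv (kappa (cls_hom f))).
by exists a; rewrite aE -cmpA cmpVm cmpm1.
Qed.

Definition nrm x y (f : hom x y) : scalar := projT1 (cid (nrm_subproof f)).

Lemma nrmK x y (f : hom x y) e : scal y (nrm f) \oc kappa e = f.
Proof. by rewrite (kappa_irr _ (cls_hom f)) /nrm; case: cid. Qed.

Lemma nrm_inj x y : injective (@nrm x y).
Proof.
by move=> f g e; rewrite -(nrmK f (cls_hom f)) e nrmK.
Qed.

Lemma nrmE x y (f : hom x y) a e : scal y a \oc kappa e = f -> nrm f = a.
Proof. by move=> aE; have := nrmK f e; rewrite -aE => /cmpmI /scal_inj. Qed.

Lemma nrm_surj x y a : cls x = cls y -> exists f : hom x y, nrm f = a.
Proof. by move=> e; exists (scal y a \oc kappa e); apply: nrmE. Qed.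

Lemma nrmM x y z (g : hom y z) (f : hom x y) :
  nrm (g \oc f) = (nrm g + nrm f)%R.
Proof.
apply: (nrmE (e := etrans (cls_hom f) (cls_hom g))).
rewrite -[in RHS](nrmK g (cls_hom g)) -[in RHS](nrmK f (cls_hom f)).
have := scal_nat (kappa (cls_hom g)) (nrm f); rewrite -kappa_cmp scalD.
move: (scal z _) (scal z _) (scal y _) (kappa _) (kappa _) => s t s' k l e.
by rewrite -!cmpA (cmpA l) e -!cmpA.
Qed.

Lemma nrm_scal x a : nrm (scal x a) = a.
Proof. by apply: (nrmE (e := erefl)); rewrite kappa_refl cmpm1. Qed.

Definition kappa2 x y u v (e : cls x = cls u) (e' : cls y = cls v) :=
  nrm (tenm (kappa e) (kappa e')).

Definition ten_cochain0 x y :=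
  kappa2 (esym (repK (cls x))) (esym (repK (cls y))).

(** Reference isomorphisms compose, so [kappa2] is additive; factoring through the representatives
    of the two classes makes it a coboundary. *)
Lemma kappa2E x y u v (e : cls x = cls u) (e' : cls y = cls v) :
  kappa2 e e' = (ten_cochain0 x y - ten_cochain0 u v)%R.
Proof.
have kappa2_cmp x' y' (e1 : cls u = cls x') (e2 : cls v = cls y') :
    (kappa2 e e' + kappa2 e1 e2 = kappa2 (etrans e e1) (etrans e' e2))%R.
  by rewrite /kappa2 addrC -nrmM -tenmM !kappa_cmp.
apply: (@addIr _ (ten_cochain0 u v)); rewrite subrK kappa2_cmp.
have gen p q (ep : cls x = cls (rep p)) (eq : cls y = cls (rep q)) :
    p = cls x -> q = cls y -> kappa2 ep eq = ten_cochain0 x y.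
  move=> pE qE; subst p q; congr nrm.
  by congr (tenm _ _); apply: kappa_irr.
exact: gen.
Qed.

Lemma nrm_ten0 x x' y y' (f : hom x x') (g : hom y y') :
  nrm (tenm f g) =
  (nrm f + nrm g + ten_cochain0 x y - ten_cochain0 x' y')%R.
Proof.
rewrite -{1}(nrmK f (cls_hom f)) -{1}(nrmK g (cls_hom g)) tenmM nrmM.
rewrite -/(kappa2 _ _) kappa2E -(cmp1m (scal x' _)) -(cmpm1 (scal y' _)) tenmM.
by rewrite nrmM scal_tenl scal_tenr !nrm_scal; abel.
Qed.

(* ten_cochain0 corrected by a function of the isomorphism classes, so as to
   make the unit constraints trivial. *)
Definition unit_correction x y : scalar :=
  if cls x == cls 'I then lunit_cochain nrm ten_cochain0 y
  else if cls y == cls 'I then runit_cochain nrm ten_cochain0 x else 0%R.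

Definition ten_cochain x y := (ten_cochain0 x y + unit_correction x y)%R.

Lemma nrm_ten x x' y y' (f : hom x x') (g : hom y y') :
  nrm (tenm f g) = (nrm f + nrm g + ten_cochain x y - ten_cochain x' y')%R.
Proof.
have -> : ten_cochain x' y' = (ten_cochain0 x' y' + unit_correction x y)%R.
  congr (_ + _)%R; rewrite /unit_correction (cls_hom f) (cls_hom g).
  rewrite (lunit_cochain_nat nrmM nrm_ten0 g).
  by rewrite (runit_cochain_nat nrmM nrm_ten0 f).
by rewrite nrm_ten0 /ten_cochain; abel.
Qed.

Lemma nrm_lunit x : nrm (lunit x) = ten_cochain 'I x.
Proof. by rewrite /ten_cochain /unit_correction eqxx /lunit_cochain; abel. Qed.

Lemma nrm_runit x : nrm (runit x) = ten_cochain x 'I.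
Proof.
rewrite /ten_cochain /unit_correction eqxx; case: eqP => [/clsP [f _]|_].
  (* For [x] isomorphic to the unit the correction is the left one; it suits the right constraint as
     well because the two cochains agree at the unit. *)
  rewrite (unit_cochain_munit nrmM nrm_ten0).
  by rewrite -(runit_cochain_nat nrmM nrm_ten0 f) /runit_cochain; abel.
by rewrite /runit_cochain; abel.
Qed.

End Scalars.

(** * The group of isomorphism classes, its cocycle, and the strict models *)

Section ClassGroup.
Variable P : picard.
Local Notation "'I" := (munit P).
Implicit Types (x y z : P) (p q r : iso_class P).

Definition cls_mul p q : iso_class P := cls (ten (rep p) (rep q)).
Definition cls_one : iso_class P := cls 'I.

Lemma cls_mulE x y : cls_mul (cls x) (cls y) = cls (ten x y).
Proof.
have [[f _] [g _]] := (to_rep_subproof x, to_rep_subproof y).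
exact/esym/cls_hom/(tenm f g).
Qed.

Lemma cls_inv_subproof p : exists q, cls_mul q p = cls_one.
Proof.
have [G [_ [t _]]] := pic_ten (rep p).
(* [G] is a quasi-inverse of tensoring with [rep p], so [G 'I] is a tensor inverse of [rep p]. *)
exists (cls (G 'I)); rewrite -(repK p) cls_mulE.
exact: cls_hom (t 'I \oc braid (G 'I) (rep p)).
Qed.

Definition cls_inv p := projT1 (cid (cls_inv_subproof p)).

Lemma cls_mulVg : left_inverse cls_one cls_inv cls_mul.
Proof. by move=> p; rewrite /cls_inv; case: cid. Qed.

Lemma cls_mulC p q : cls_mul p q = cls_mul q p.
Proof. exact: cls_hom (braid _ _). Qed.

Lemma cls_mulgV : right_inverse cls_one cls_inv cls_mul.
Proof. by move=> p; rewrite cls_mulC cls_mulVg. Qed.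

Lemma cls_mulA : associative cls_mul.
Proof.
move=> p q r; rewrite -(repK p) -(repK q) -(repK r) !cls_mulE.
exact/esym/cls_hom/asc.
Qed.

Lemma cls_mul1g : left_id cls_one cls_mul.
Proof. by move=> p; rewrite -(repK p) cls_mulE; apply: cls_hom (lunit _). Qed.

Lemma cls_mulg1 : right_id cls_one cls_mul.
Proof. by move=> p; rewrite cls_mulC cls_mul1g. Qed.

HB.instance Definition _ := isGroup.Build (iso_class P)
  cls_mulA cls_mul1g cls_mulg1 cls_mulVg cls_mulgV.

Lemma clsM x y : cls (ten x y) = cls x * cls y.
Proof. by rewrite -cls_mulE. Qed.

Lemma iso_classC p q : p * q = q * p.
Proof. exact: cls_mulC. Qed.

Let d := @ten_cochain P.
Let h := assoc_cocycle (@nrm P) d.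
Let c := braid_cocycle (@nrm P) d.

Definition cls_assoc p q r := h (rep p) (rep q) (rep r).
Definition cls_braid p q := c (rep p) (rep q).

Lemma cls_assocE x y z : h x y z = cls_assoc (cls x) (cls y) (cls z).
Proof.
exact: assoc_cocycle_nat (@nrmM P) (@nrm_ten P) _ _ _ _ _ _
  (to_rep x) (to_rep y) (to_rep z).
Qed.

Lemma cls_braidE x y : c x y = cls_braid (cls x) (cls y).
Proof.
exact: braid_cocycle_nat (@nrmM P) (@nrm_ten P) _ _ _ _ (to_rep x) (to_rep y).
Qed.

Lemma cls_assocP s p q r :
  (cls_assoc p q r + cls_assoc s (p * q) r + cls_assoc s p q =
   cls_assoc (s * p) q r + cls_assoc s p (q * r))%R.
Proof.
have := assoc_cocycleP (@nrmM P) (@nrm_ten P) (rep s) (rep p) (rep q) (rep r).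
by rewrite -/h !cls_assocE !clsM !repK.
Qed.

Lemma cls_assoc_1m p q : cls_assoc p 1 q = 0%R.
Proof.
rewrite -(repK p) -(repK q) -cls_assocE.
rewrite /h (assoc_cocycle_unit (@nrmM P) (@nrm_ten P)).
by rewrite /runit_cochain /lunit_cochain nrm_lunit nrm_runit !subrr.
Qed.

Lemma cls_assoc_1l p q : cls_assoc 1 p q = 0%R.
Proof.
have := cls_assocP 1 1 p q; rewrite !mul1g !cls_assoc_1m => e.
abel_using e.
Qed.

Lemma cls_assoc_1r p q : cls_assoc p q 1 = 0%R.
Proof.
have := cls_assocP p q 1 1; rewrite !mulg1 !cls_assoc_1m => e.
abel_using e.
Qed.

Lemma cls_braidN p q : cls_braid q p = (- cls_braid p q)%R.
Proof. exact: braid_cocycleN (@nrmM P) _ _. Qed.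

Lemma cls_hexagon p q r :
  (cls_assoc q r p + cls_braid p (q * r) + cls_assoc p q r =
   cls_braid p r + cls_assoc q p r + cls_braid p q)%R.
Proof.
have := braid_cocycle_hexagon (@nrmM P) (@nrm_ten P) (rep p) (rep q) (rep r).
by rewrite -/h -/c !cls_assocE !cls_braidE !clsM !repK.
Qed.

Lemma cls_braid_1r p : cls_braid p 1 = 0%R.
Proof.
have := cls_hexagon p 1 1.
rewrite mulg1 !cls_assoc_1m cls_assoc_1l => e.
abel_using e.
Qed.

Lemma cls_braid_1l p : cls_braid 1 p = 0%R.
Proof. by rewrite cls_braidN cls_braid_1r oppr0. Qed.

(* An element (p, u) is a strict model of an object of class p: the function u
   measures the isomorphism from p (x) x to the representative of p * x.
   Hence the tensor product of these models is strictly associative. *)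
Record model := Model {
  mcls : iso_class P;
  mfun : iso_class P -> scalar P;
  mfun1 : mfun 1 = 0%R }.
HB.instance Definition _ := gen_eqMixin model.
HB.instance Definition _ := gen_choiceMixin model.
Implicit Types u v w : model.

Lemma model_eq u v :
  mcls u = mcls v -> (forall p, mfun u p = mfun v p) -> u = v.
Proof.
case: u => p f f1; case: v => q g g1 /= <- /funext e; subst g.
by rewrite (Prop_irrelevance f1 g1).
Qed.

(** The measures of [u] and [v] are composed through the associator; the subtracted constant
    normalizes the value at 1 to zero. Associativity is then the cocycle identity [cls_assocP]. *)
Definition mul_fun u v p : scalar P :=
  (mfun u (mcls v * p)%g + mfun v p - mfun u (mcls v) +
   cls_assoc (mcls u) (mcls v) p)%R.

Lemma mul_fun1 u v : mul_fun u v 1 = 0%R.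
Proof. by rewrite /mul_fun mulg1 mfun1 cls_assoc_1r; abel. Qed.

Definition inv_fun u p : scalar P :=
  (mfun u (mcls u)^-1%g - mfun u ((mcls u)^-1 * p)%g +
   cls_assoc (mcls u)^-1 (mcls u) (mcls u)^-1 -
   cls_assoc (mcls u)^-1 (mcls u) ((mcls u)^-1 * p)%g)%R.

Lemma inv_fun1 u : inv_fun u 1 = 0%R.
Proof. by rewrite /inv_fun mulg1; abel. Qed.

Definition model_mul u v := @Model (mcls u * mcls v) (mul_fun u v) (mul_fun1 u v).
Definition model_one := @Model 1 (fun _ => 0%R) erefl.
Definition model_inv u := @Model (mcls u)^-1 (inv_fun u) (inv_fun1 u).

Lemma model_mulA : associative model_mul.
Proof.
move=> u v w; apply: model_eq => [|p] /=; first exact: mulgA.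
rewrite /mul_fun /= /mul_fun.
have e := cls_assocP (mcls u) (mcls v) (mcls w) p.
have mA (q r s : iso_class P) : q * (r * s) = q * r * s by apply: mulgA.
by rewrite !mA in e *; abel_using e.
Qed.

Lemma model_mul1g : left_id model_one model_mul.
Proof.
move=> u; apply: model_eq => [|p] /=; first exact: mul1g.
by rewrite /mul_fun /= cls_assoc_1l; abel.
Qed.

Lemma model_mulg1 : right_id model_one model_mul.
Proof.
move=> u; apply: model_eq => [|p] /=; first exact: mulg1.
by rewrite /mul_fun /= cls_assoc_1m mul1g mfun1; abel.
Qed.

Lemma model_mulVg : left_inverse model_one model_inv model_mul.
Proof.
move=> u; apply: model_eq => [|p] /=; first exact: mulVg.
rewrite /mul_fun /= /inv_fun !mulKg !mulVg mfun1 cls_assoc_1r; abel.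
Qed.

Lemma model_mulgV : right_inverse model_one model_inv model_mul.
Proof.
move=> u; rewrite -[LHS]model_mul1g -{1}(model_mulVg (model_inv u)) -model_mulA.
by rewrite (model_mulA _ u) model_mulVg model_mul1g model_mulVg.
Qed.

HB.instance Definition _ := isGroup.Build model
  model_mulA model_mul1g model_mulg1 model_mulVg model_mulgV.

Lemma mcls_morph : monoid_morphism mcls. Proof. by []. Qed.
HB.instance Definition _ :=
  isUMagmaMorphism.Build model (iso_class P) mcls mcls_morph.

End ClassGroup.

(** * The stable quadratic module of a Picard groupoid *)

Section Presentation.
Variable P : picard.
Local Notation "'I" := (munit P).
Local Notation E := (obj P).
Local Notation G := (free_group E).
Local Notation A := (scalar P).
Local Notation g := (@free_gen E).
Implicit Types (x y z k l n : G) (p q r : iso_class P) (a b : A) (u v w : P).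

Let d := @ten_cochain P.

Definition gen_model u : model P := @Model P (cls u) (fun _ => 0%R) erefl.
Definition free_model : G -> model P := free_lift gen_model.
HB.instance Definition _ := UMagmaMorphism.on free_model.

Definition free_cls x : iso_class P := mcls (free_model x).
Lemma free_cls_morph : monoid_morphism free_cls.
Proof. by split=> [|x y]; rewrite /free_cls ?gmulf1 ?gmulfM. Qed.
HB.instance Definition _ :=
  isUMagmaMorphism.Build G (iso_class P) free_cls free_cls_morph.

Lemma free_cls_gen u : free_cls (g u) = cls u.
Proof. by rewrite /free_cls /free_model free_lift_gen. Qed.

Definition beta x y : A := mfun (free_model x) (free_cls y).

Lemma beta_gen u y : beta (g u) y = 0%R.
Proof. by rewrite /beta /free_model free_lift_gen. Qed.

Lemma beta_kerr x k : free_cls k = 1 -> beta x k = 0%R.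
Proof. by rewrite /beta => ->; apply: mfun1. Qed.

(** This is multiplicativity of [free_model]: over the free group the associativity cocycle is the
    coboundary of [beta]. Freeness enters through the existence of the homomorphism [free_model]. *)
Lemma beta_cocycle x y z :
  (beta (x * y)%g z = beta x (y * z)%g + beta y z - beta x y +
     cls_assoc (free_cls x) (free_cls y) (free_cls z))%R.
Proof. by rewrite /beta !gmulfM. Qed.

Lemma beta_kerl x k y : free_cls k = 1 ->
  beta (x * k) y = (beta x y + beta k y)%R.
Proof.
move=> kP; rewrite beta_cocycle (beta_kerr _ kP) kP cls_assoc_1m.
have -> : beta x (k * y) = beta x y by rewrite /beta gmulfM /= kP mul1g.
abel.
Qed.

Lemma free_clsR x y : free_cls [~ x, y] = 1.
Proof. by rewrite gmulfR; apply/eqP/commgP/iso_classC. Qed.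

Lemma free_cls_derived k : derived_commg k -> free_cls k = 1.
Proof.
exact/derived_commg_lift/(fun x y => iso_classC (free_cls x) (free_cls y)).
Qed.

Definition gam x y : A :=
  (cls_braid (free_cls y) (free_cls x) + beta x y - beta y x)%R.

Lemma gamN x y : gam y x = (- gam x y)%R.
Proof. by rewrite /gam cls_braidN; abel. Qed.

Lemma gam_ker x k : free_cls k = 1 -> gam x k = (- beta k x)%R.
Proof. by move=> kP; rewrite /gam kP cls_braid_1l (beta_kerr _ kP); abel. Qed.

Lemma gam_ker0 k l : free_cls k = 1 -> free_cls l = 1 -> gam k l = 0%R.
Proof. by move=> kP lP; rewrite (gam_ker _ lP) (beta_kerr _ kP) oppr0. Qed.

(** The hexagon, with its associators rewritten by [beta_cocycle]. Since [x * y] and [y * x] differ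
    in the free group, [beta [~ x, y] z] is left over; this is the last term up to sign. *)
Lemma gamMl x y z : gam (y * z) x = (gam y x + gam z x + gam z [~ x, y])%R.
Proof.
rewrite (gam_ker _ (free_clsR x y)).
have := beta_kerl (y * x) z (free_clsR x y); rewrite -commgC => e1.
have e2 := cls_hexagon (free_cls x) (free_cls y) (free_cls z).
move: (beta [~ x, y] z) e1 => t; rewrite !beta_cocycle => e1.
have zx : beta y (x * z) = beta y (z * x).
  by rewrite /beta !gmulfM [_ * free_cls z]iso_classC.
rewrite /gam !gmulfM /= !beta_cocycle zx in e1 *.
apply: (abel_from (esym e1)); abel_using e2.
Qed.

Lemma psi_subproof : exists psi : G -> A,
    (forall k l, derived_commg k -> derived_commg l ->
       psi (k * l)%g = psi k + psi l)%R /\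
    (forall k x, derived_commg k -> psi (k ^ x)%g = psi k + gam x k)%R.
Proof.
apply: (coherence gamN gamMl) => k l /free_cls_derived kP /free_cls_derived lP.
exact: gam_ker0.
Qed.

Definition psi : G -> A := projT1 (cid psi_subproof).

Lemma psiM k l : derived_commg k -> derived_commg l ->
  psi (k * l) = (psi k + psi l)%R.
Proof. exact: (projT2 (cid psi_subproof)).1. Qed.

Lemma psiJ k x : derived_commg k -> psi (k ^ x) = (psi k + gam x k)%R.
Proof. exact: (projT2 (cid psi_subproof)).2. Qed.

Lemma psi1 : psi 1 = 0%R.
Proof.
have D1 := dcommg_one G.
by apply: (@addrI _ (psi 1)); rewrite -psiM // mulg1 addr0.
Qed.

Lemma psiV k : derived_commg k -> psi k^-1 = (- psi k)%R.
Proof.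
move=> kD; apply: (@addrI _ (psi k)).
by rewrite -psiM ?mulgV ?psi1 ?addrN //; apply: dcommg_inv.
Qed.

Lemma psiR k x : derived_commg k -> psi [~ k, x] = gam x k.
Proof.
move=> kD; rewrite commgEl psiM ?psiV ?psiJ ?addKr //.
  exact: dcommg_inv.
exact: dcommg_conj.
Qed.

(* The automorphisms k -> 1 of the strict model: k is an object isomorphic to
   the unit, and a is the value of the isomorphism. *)
Record kel := Kel { kob : G; kval : A; kobP : free_cls kob = 1 }.
HB.instance Definition _ := gen_eqMixin kel.
HB.instance Definition _ := gen_choiceMixin kel.
Implicit Types s t : kel.

Lemma kel_eq s t : kob s = kob t -> kval s = kval t -> s = t.
Proof.
case: s => k a kP; case: t => l b lP /= ? ?; subst l b.
by rewrite (Prop_irrelevance kP lP).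
Qed.

Lemma kmul_subproof s t : free_cls (kob s * kob t) = 1.
Proof. by rewrite gmulfM /= !kobP mulg1. Qed.

Lemma kinv_subproof s : free_cls (kob s)^-1 = 1.
Proof. by rewrite gmulfV /= kobP invg1. Qed.

Definition kmul s t := Kel (kval s + kval t)%R (kmul_subproof s t).
Definition kone := Kel 0%R (@gmulf1 _ _ free_cls).
Definition kinv s := Kel (- kval s)%R (kinv_subproof s).

Lemma kmulA : associative kmul.
Proof. by move=> s t r; apply: kel_eq; rewrite /= ?mulgA ?addrA. Qed.

Lemma kmul1g : left_id kone kmul.
Proof. by move=> s; apply: kel_eq; rewrite /= ?mul1g ?add0r. Qed.

Lemma kmulg1 : right_id kone kmul.
Proof. by move=> s; apply: kel_eq; rewrite /= ?mulg1 ?addr0. Qed.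

Lemma kmulVg : left_inverse kone kinv kmul.
Proof. by move=> s; apply: kel_eq; rewrite /= ?mulVg ?addNr. Qed.

Lemma kmulgV : right_inverse kone kinv kmul.
Proof. by move=> s; apply: kel_eq; rewrite /= ?mulgV ?addrN. Qed.

HB.instance Definition _ := isGroup.Build kel kmulA kmul1g kmulg1 kmulVg kmulgV.

(** The graph of [psi] over the triple commutators: dividing by it identifies each triple commutator
    with the unit along the isomorphism that [psi] selects. *)
Definition coh s : Prop := triple_commg (kob s) /\ kval s = psi (kob s).

Lemma coh1 : coh 1.
Proof. by split; [apply: tcommg_one | rewrite /= psi1]. Qed.

Lemma cohM s t : coh s -> coh t -> coh (s * t).
Proof.
move=> [sT sE] [tT tE]; split; first exact: tcommg_mul.
by rewrite /= sE tE psiM //; apply: triple_derived.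
Qed.

Lemma cohV s : coh s -> coh s^-1.
Proof.
move=> [sT sE]; split; first exact: tcommg_inv.
by rewrite /= sE psiV //; apply: triple_derived.
Qed.

Lemma cohJ s t : coh s -> coh (s ^ t).
Proof.
move=> [sT sE]; split; first exact: tcommg_conj.
rewrite -[kob (s ^ t)]/(kob s ^ kob t) psiJ ?gam_ker0 ?kobP //; last first.
  exact: triple_derived.
by rewrite /= sE; abel.
Qed.

Definition kcoh := NormalPred coh1 cohM cohV cohJ.
Definition gtriple := NormalPred (@tcommg_one G) (@tcommg_mul G) (@tcommg_inv G)
  (@tcommg_conj G).

Local Notation C0 := (quot_group gtriple).
Local Notation C1 := (quot_group kcoh).
Local Notation pi0 := (@quot_pi _ gtriple).
Local Notation pi1 := (@quot_pi _ kcoh).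

Lemma kob_morph : monoid_morphism kob.
Proof. by []. Qed.
HB.instance Definition _ := isUMagmaMorphism.Build kel G kob kob_morph.

Lemma bdry_subproof : exists f : UMagmaMorphism.type C1 C0,
  forall s, f (pi1 s) = pi0 (kob s).
Proof.
have pi1_surj (y : C1) : exists s, pi1 s = y.
  by exists (quot_repr y); apply: quot_reprK.
have ker s : pi1 s = 1 -> pi0 (kob s) = 1.
  by move=> /quot_pi_eq1 [sT _]; apply/quot_pi_eq1.
exact: (descent (q := pi1) (f := pi0 \o kob) pi1_surj ker).
Qed.

Definition bdry : UMagmaMorphism.type C1 C0 := projT1 (cid bdry_subproof).

Lemma bdryE s : bdry (pi1 s) = pi0 (kob s).
Proof. exact: projT2 (cid bdry_subproof) s. Qed.

Definition kbrk x y : C1 := pi1 (Kel (gam x y) (free_clsR y x)).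

Lemma pi1_eq s t : kob s = kob t -> kval s = kval t -> pi1 s = pi1 t.
Proof. by move=> e e'; rewrite (kel_eq e e'). Qed.

Lemma pi1_ext s t : triple_commg ((kob s)^-1 * kob t) ->
  (kval t = kval s + psi ((kob s)^-1 * kob t)%g)%R -> pi1 s = pi1 t.
Proof.
move=> sT e; apply/quot_piP; split=> //=.
by rewrite e addKr.
Qed.

(** Two defects cancel modulo [coh]: [[~ z, x * y]] differs from [[~ z, x] * [~ z, y]] by triple
    commutators, and [psiR] gives [psi] on them exactly the last term of [gamMl]. *)
Lemma kbrkMl x y z : kbrk (x * y) z = kbrk x z * kbrk y z.
Proof.
pose k := [~ z, x]; pose l := [~ z, y].
have kD : derived_commg k by apply: dcommg_comm.
have e : [~ z, x * y]^-1 * (k * l) = [~ k, y]^-1 * [~ k, l].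
  have -> : [~ z, x * y] = l * k ^ y.
    by rewrite /k /l /commg /conjg !invgM !mulgA !mulgK.
  move: k l {kD} => k l.
  rewrite (commgEl k y) (commgEl k l) (conjgE k l); move: (k ^ y) => m.
  by rewrite !invgM invgK -!mulgA mulVKg.
rewrite /kbrk -gmulfM; apply: pi1_ext; rewrite /= -/k -/l e.
  by apply: tcommg_mul; [apply: tcommg_inv|]; apply: tcommg_comm.
rewrite psiM ?psiV ?psiR //; try exact: dcommg_comm; last first.
  exact/dcommg_inv/dcommg_comm.
by rewrite gamMl -/k (gam_ker0 (free_clsR _ _) (free_clsR _ _)); abel.
Qed.

Lemma kbrk_anti x y : kbrk x y * kbrk y x = 1.
Proof.
rewrite /kbrk -gmulfM (_ : 1 = pi1 1) //; apply: pi1_eq => /=.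
  by rewrite -invgR mulVg.
by rewrite (gamN x y) addrN.
Qed.

Lemma kbrkC x y x' y' : kbrk x y * kbrk x' y' = kbrk x' y' * kbrk x y.
Proof.
pose k := [~ y, x]; pose l := [~ y', x'].
have e : (k * l)^-1 * (l * k) = [~ l, k].
  by move: (k) (l) => m n; rewrite /commg /conjg invgM -!mulgA.
rewrite /kbrk -!gmulfM; apply: pi1_ext; rewrite /= -/k -/l e.
  exact: tcommg_comm.
rewrite psiR; last exact: dcommg_comm.
by rewrite (gam_ker0 (free_clsR y x) (free_clsR y' x')); abel.
Qed.

(** As [[~ y, n] = (n ^ y)^-1 * n], the rule [psiJ] evaluates [psi] there to [gam n y], so the pair
    lies in [coh]. Hence the bracket descends to the quotient. *)
Lemma kbrk_triple n y : triple_commg n -> kbrk n y = 1.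
Proof.
move=> nT; have nD := triple_derived nT.
have nyD : derived_commg (n ^ y) by apply: dcommg_conj.
have yn : [~ y, n] = (n ^ y)^-1 * n by rewrite -conjVg /commg /conjg !mulgA.
apply/quot_pi_eq1; split=> /=; rewrite yn.
  by apply: (tcommg_mul _ nT); apply/tcommg_inv/tcommg_conj.
by rewrite (psiM (dcommg_inv nyD) nD) psiV // psiJ // (gamN y n); abel.
Qed.

Lemma kbrk_congr x x' y y' :
  pi0 x = pi0 x' -> pi0 y = pi0 y' -> kbrk x y = kbrk x' y'.
Proof.
have congl z z' l : pi0 z = pi0 z' -> kbrk z l = kbrk z' l.
  by move=> /quot_piP zz'; rewrite -(mulVKg z z') kbrkMl (kbrk_triple _ zz') mulg1.
move=> xx' yy'; rewrite (congl _ _ _ xx').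
apply: (@mulIg _ (kbrk y x')); rewrite kbrk_anti (congl _ _ _ yy').
by rewrite kbrk_anti.
Qed.

Definition pres_brk (p q : C0) : C1 := kbrk (quot_repr p) (quot_repr q).

Lemma pres_brkE x y : pres_brk (pi0 x) (pi0 y) = kbrk x y.
Proof. by apply: kbrk_congr; rewrite quot_reprK. Qed.

Program Definition presentation : sqmod :=
  @SQMod C0 C1 bdry pres_brk _ _ _ _ _.
Next Obligation.
move=> x y z; rewrite -(quot_reprK x) -(quot_reprK y) -(quot_reprK z).
by rewrite -gmulfM !pres_brkE kbrkMl.
Qed.
Next Obligation.
move=> x y z; rewrite -(quot_reprK x) -(quot_reprK y) -(quot_reprK z).
rewrite -gmulfM !pres_brkE.
have kN k l : kbrk k l = (kbrk l k)^-1.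
  by apply/divg1_eq; rewrite invgK kbrk_anti.
rewrite kN kbrkMl invgM -!kN.
exact: kbrkC.
Qed.
Next Obligation.
move=> x y; rewrite -(quot_reprK x) -(quot_reprK y) !pres_brkE.
exact: kbrk_anti.
Qed.
Next Obligation.
move=> x y; rewrite -(quot_reprK x) -(quot_reprK y) pres_brkE bdryE /=.
by rewrite gmulfR.
Qed.
Next Obligation.
move=> a b; rewrite -(quot_reprK a) -(quot_reprK b) !bdryE pres_brkE.
rewrite -gmulfR; apply: pi1_eq => //=.
by rewrite gam_ker0 ?kobP //; abel.
Qed.

Lemma presentation_zero_free : free_nil2 (sq0 presentation).
Proof.
exists E, pi0; split=> [y|x]; last exact: quot_pi_eq1.
by exists (quot_repr y); apply: quot_reprK.
Qed.

Lemma pi1M s t : pi1 s * pi1 t = pi1 (s * t).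
Proof. by rewrite gmulfM. Qed.

Lemma kact_subproof s x : free_cls (kob s ^ x) = 1.
Proof. by rewrite gmulfJ /= kobP conj1g. Qed.

Definition kact s x := Kel (kval s + gam x (kob s))%R (kact_subproof s x).

Lemma act_pi1 s x : @act presentation (pi1 s) (pi0 x) = pi1 (kact s x).
Proof.
rewrite /act /= bdryE pres_brkE pi1M; apply: pi1_eq => //=.
by rewrite commgEl mulVKg.
Qed.

Lemma shift_subproof x y : free_cls x = free_cls y -> free_cls (y^-1 * x) = 1.
Proof. by move=> e; rewrite gmulfM gmulfV /= e mulVg. Qed.

Definition kshift x y (e : free_cls x = free_cls y) a := Kel a (shift_subproof e).

Lemma pres_hom_subproof (c0 : C0) x y (ep : c0 = pi0 x)
    (e : free_cls x = free_cls y) a :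
  c0 = pi0 y * bdry (pi1 (kshift e a)).
Proof. by rewrite bdryE -gmulfM /= mulVKg. Qed.

(** The source [c0] is kept apart from [pi0 x] so that products such as [pi0 x * pi0 y] serve as
    sources without transport. *)
Definition pres_hom (c0 : C0) x y (ep : c0 = pi0 x) (e : free_cls x = free_cls y) a :
    @ghom presentation c0 (pi0 y) :=
  @GHom presentation c0 (pi0 y) (pi1 (kshift e a)) (pres_hom_subproof ep e a).

Lemma pres_hom_surj x y (f : @ghom presentation (pi0 x) (pi0 y)) :
  exists e a, f = pres_hom (erefl (pi0 x)) (e : free_cls x = free_cls y) a.
Proof.
have [s sE] : exists s, pi1 s = gval f.
  by exists (quot_repr (gval f)); apply: quot_reprK.
have /esym := gvalP f; rewrite -sE [bd _]bdryE -gmulfM => /quot_piP nT.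
have e : free_cls x = free_cls y.
  have := free_cls_derived (triple_derived nT).
  by rewrite gmulfM gmulfV gmulfM /= kobP mulg1 => /mulg1_eq; rewrite invgK.
(* [y * kob s] equals [x] only up to a triple commutator; the term [psi] corrects the scalar
   accordingly. *)
exists e, (kval s + psi ((y * kob s)^-1 * x))%R; apply: ghom_eq.
have eT : (kob s)^-1 * (y^-1 * x) = (y * kob s)^-1 * x by rewrite invgM mulgA.
by rewrite -sE; apply: pi1_ext; rewrite /= eT.
Qed.

(** No scalar is lost in the quotient: above the neutral element, [coh] contains only the scalar
    [psi 1 = 0]. *)
Lemma pres_hom_inj x y (e : free_cls x = free_cls y) a b :
  pres_hom (erefl (pi0 x)) e a = pres_hom (erefl (pi0 x)) e b -> a = b.
Proof.
move=> /(congr1 (@gval _ _ _)) /= /quot_piP [_ /=]; rewrite mulVg psi1.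
by rewrite addrC => /subr0_eq.
Qed.

Lemma gen_cls u v : cls u = cls v -> free_cls (g u) = free_cls (g v).
Proof. by rewrite !free_cls_gen. Qed.

Program Definition pres_functor : functor P (gamma_pic presentation) :=
  @Functor P (gamma_pic presentation) (fun u => pi0 (g u))
    (fun u v f => pres_hom erefl (gen_cls (cls_hom f)) (nrm f)) _ _.
Next Obligation.
move=> u; apply: ghom_eq => /=; rewrite (_ : 1 = pi1 1) //.
by apply: pi1_eq; rewrite /= ?mulVg ?(nrm1 (@nrmM P)).
Qed.
Next Obligation.
move=> u v w h f; apply: ghom_eq => /=; rewrite pi1M.
by apply: pi1_eq; rewrite /= ?nrmM // -mulgA mulVKg.
Qed.

Lemma gen_mul_cls u v : free_cls (g u * g v) = free_cls (g (ten u v)).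
Proof. by rewrite gmulfM /= !free_cls_gen clsM. Qed.

Definition pres_mul u v :
    @ghom presentation (pi0 (g u) * pi0 (g v)) (pi0 (g (ten u v))) :=
  pres_hom (esym (@gmulfM _ _ pi0 (g u) (g v))) (gen_mul_cls u v) (- d u v)%R.

Lemma gen_unit_cls : free_cls 1 = free_cls (g 'I).
Proof. by rewrite gmulf1 free_cls_gen. Qed.

Definition pres_unit : @ghom presentation 1 (pi0 (g 'I)) :=
  pres_hom (esym (@gmulf1 _ _ pi0)) gen_unit_cls 0%R.

Lemma beta_shift x y z (e : free_cls x = free_cls y) :
  beta (y^-1 * x) z = (beta x z - beta y z)%R.
Proof.
have := beta_kerl y z (shift_subproof e).
by rewrite mulVKg => ->; abel.
Qed.

Lemma kact_shift x y z (e : free_cls x = free_cls y) a :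
  kval (kact (kshift e a) z) = (a + beta y z - beta x z)%R.
Proof. by rewrite /= (gam_ker _ (shift_subproof e)) beta_shift //; abel. Qed.

(** Each law splits into a cancellation in the free group and an equation of scalars. Naturality is
    [nrm_ten]; associativity is [beta_cocycle] with [beta] zero on generators; the unit laws use the
    normalization of [ten_cochain]; symmetry is the definition of [gam]. *)
Program Definition pres_tensor : tensor_functor P (gamma_pic presentation) :=
  @TensorFunctor P (gamma_pic presentation) pres_functor pres_mul pres_unit
    _ _ _ _ _.
Next Obligation.
move=> u u' v v' f k; apply: ghom_eq => /=.
rewrite act_pi1 (pi1M (kact _ _) (kshift _ _)) (pi1M (kshift _ _) (_ * _)).
rewrite (pi1M (kshift _ _) (kshift _ _)); apply: pi1_eq.
  by rewrite /= /conjg !mulgA !mulgK.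
change (- d u' v' + (kval (kact (kshift (gen_cls (cls_hom f)) (nrm f)) (g v')) +
  nrm k) = nrm (tenm f k) - d u v)%R.
by rewrite kact_shift !beta_gen nrm_ten /d; abel.
Qed.
Next Obligation.
move=> u v w; apply: ghom_eq => /=.
rewrite act_pi1 !(act1, mul1g, mulg1) !(pi1M (kshift _ _) (kshift _ _)).
rewrite (pi1M (_ * _) (kact _ _)); apply: pi1_eq.
  by rewrite /= /conjg !mulgA !mulgK.
change (nrm (asc u v w) - d (ten u v) w +
  kval (kact (kshift (gen_mul_cls u v) (- d u v)) (g w)) =
  - d u (ten v w) - d v w)%R.
rewrite kact_shift beta_cocycle !beta_gen !free_cls_gen -cls_assocE.
by rewrite /assoc_cocycle /d; abel.
Qed.
Next Obligation.
move=> u; apply: ghom_eq => /=.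
rewrite act_pi1 !(act1, mul1g, mulg1) (pi1M (kshift _ _) (kshift _ _)).
rewrite (pi1M (_ * _) (kact _ _)) (_ : 1 = pi1 1) //; apply: pi1_eq.
  by rewrite /= /conjg mulg1 !mulgA !mulgK mulVg.
change (nrm (lunit u) - d 'I u + kval (kact (kshift gen_unit_cls 0) (g u)) = 0)%R.
rewrite kact_shift beta_gen nrm_lunit.
have -> : beta 1 (g u) = 0%R by rewrite /beta gmulf1.
by rewrite /d; abel.
Qed.
Next Obligation.
move=> u; apply: ghom_eq => /=.
rewrite !(act1, mul1g, mulg1) (pi1M (kshift _ _) (kshift _ _)).
rewrite (pi1M (_ * _) (kshift _ _)) (_ : 1 = pi1 1) //; apply: pi1_eq.
  by rewrite /= mulg1 !mulgA !mulgK mulVg.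
by rewrite /= nrm_runit /d; abel.
Qed.
Next Obligation.
move=> u v; apply: ghom_eq => /=.
rewrite pres_brkE (pi1M (kshift _ _) (kshift _ _)) (pi1M (kshift _ _) (Kel _ _)).
apply: pi1_eq.
  by rewrite /= -(mulgA _ _ [~ _, _]) -commgC -mulgA mulVKg.
rewrite /= /gam !free_cls_gen -cls_braidE !beta_gen /braid_cocycle /d.
abel.
Qed.

Lemma pres_equivalent : @equivalent picard_twocat P (gamma_pic presentation).
Proof.
apply: (@ff_surj_equivalent P (gamma_pic presentation) pres_tensor).
- move=> u v f; have [e [a ->]] := pres_hom_surj f.
  have e' : cls u = cls v by rewrite -!free_cls_gen.
  have [k kE] := nrm_surj a e'; exists k.
  by apply: ghom_eq; apply: pi1_eq.
- move=> u v f k /= e; apply: nrm_inj.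
  apply: (pres_hom_inj (e := gen_cls (cls_hom f))).
  rewrite e; apply: ghom_eq; exact: pi1_eq.
(* Every class contains a generator, namely its representative object; two elements of the same
   class are joined by a morphism of any scalar, here 0. *)
- move=> c; exists (rep (free_cls (quot_repr c))).
  have e : free_cls (g (rep (free_cls (quot_repr c)))) = free_cls (quot_repr c).
    by rewrite free_cls_gen repK.
  have := pres_hom erefl e 0%R; rewrite quot_reprK => f.
  by exists f.
Qed.

End Presentation.

Lemma equivalent_sym (K : twocat) (a b : K) : equivalent a b -> equivalent b a.
Proof. by case=> f [g [gf fg]]; exists g, f. Qed.

Theorem corollary3p4p5 : weak_equivalence (full_twofunctor zero_free Gamma).
Proof.
split.
- by move=> C D f g; apply: gamma_htp_bij.
- by move=> C D F; apply: gamma_mor_surj F (svalP C).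
- move=> P; exists (exist zero_free (presentation P) (presentation_zero_free P)).
  exact/equivalent_sym/pres_equivalent.
Qed.
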